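(* Let $G_1=\langle X_1\mid R_1\rangle$ and $G_2=\langle X_2\mid R_2\rangle$ be groups with $X_1$, $X_2$ finite and $R_1$, $R_2$ not necessarily finite. Suppose that there exist a set $P$ of infinitely many primes, a freely reduced $X_1$-word $w$ (the same for all $p\in P$), and a collection $\{\Gamma_p\}_{p\in P}$ of $X_1$-graphs such that for every $p\in P$: $\Gamma_p$ is an $X_1$-regular connected $X_1$-graph which fulfills the defining relators $R_1$ and has exactly $p$ vertices, and there is a base-vertex $v$ of $\Gamma_p$ such that $$\{t(p_i)\mid 0\le i<p\}=V(\Gamma_p),$$ where $p_i$ denotes the reduced path in $\Gamma_p$ with origin $o(p_i)=v$ and label $\mu(p_i)=w^i$. Then the nerve complex $\mathcal{NC}(G,\mathscr H_{\mathrm{fi}})$ and the order complex $\Delta P_{\mathrm{fi}}(G)$ are contractible for $G=G_1\ast G_2$, $G=G_1\times G_2$ or $G=G_2\rtimes G_1$.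
   Context: $G_1\ast G_2$ is the free product, $G_1\times G_2$ the direct product, and $G_2\rtimes G_1$ a semidirect product with normal subgroup $G_2$ formed with respect to any homomorphism $G_1\to\mathrm{Aut}(G_2)$. For a group $G$: $\mathscr H_{\mathrm{fi}}$ is the set of all proper finite index subgroups of $G$, and $P_{\mathrm{fi}}(G)=\{Hg\mid H<G \text{ proper},\ [G:H]<\infty,\ g\in G\}$ is the set of all right cosets of such subgroups, partially ordered by inclusion. The order complex $\Delta P$ of a poset $P$ is the simplicial complex whose $n$-simplices are the chains $C_0\subset C_1\subset\dots\subset C_n$ in $P$. The nerve complex $\mathcal{NC}(G,\mathscr H)$ of $G$ with respect to a set $\mathscr H$ of subgroups is the simplicial complex with an $n$-simplex for every set $\{H_0g_0,\dots,H_ng_n\}$ of $n+1$ cosets with $H_i\in\mathscr H$, $g_i\in G$ and $H_0g_0\cap\dots\cap H_ng_n\ne\emptyset$. For a finite set $X$, $F(X)$ is the free group on $X$, realized as the freely reduced words in $X\cup X^{-1}$ (powers $w^i$ are taken in $F(X)$, i.e. freely reduced); relators are elements of $F(X)$. An $X$-graph is a directed graph $\Gamma$ (loops and multiple edges allowed) in which every directed edge $e$, with origin $o(e)$ and terminus $t(e)$, carries a label $\mu(e)\in X$. $\widehat\Gamma$ is obtained by adding, for each edge $e$, a formal inverse $e^{-1}$ with $o(e^{-1})=t(e)$, $t(e^{-1})=o(e)$, $\mu(e^{-1})=\mu(e)^{-1}$. A path $p$ in $\Gamma$ is a sequence $e_1,\dots,e_k$ of edges of $\widehat\Gamma$ with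 $o(e_i)=t(e_{i-1})$; $o(p)=o(e_1)$, $t(p)=t(e_k)$, $\mu(p)=\mu(e_1)\cdots\mu(e_k)$; a single vertex is also a path, with empty label. A path is reduced if it has no subpath $e,e^{-1}$ with $e$ an edge of $\widehat\Gamma$. $\Gamma$ is $X$-regular if for every vertex $v$ and every $x\in X\cup X^{-1}$ there is exactly one edge in $\widehat\Gamma$ with origin $v$ and label $x$. $\Gamma$ fulfills a set $R$ of relators if for every vertex $v$ and every $r\in R$, each reduced path with origin $v$ and label $r$ has terminus $v$. *)

(* Defs.v *)
From HB Require Import structures.
From mathcomp Require Import all_boot all_order all_algebra finmap.
From mathcomp Require Import generic_quotient.
From mathcomp Require Import all_classical all_reals all_analysis.

Set Implicit Arguments.
Unset Strict Implicit.
Unset Printing Implicit Defensive.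

Import Order.TTheory GRing.Theory Num.Theory.
Import numFieldNormedType.Exports.

Local Open Scope classical_set_scope.
Local Open Scope quotient_scope.

(* Letters of X u X^-1: (x, false) is x and (x, true) is x^-1. *)
Definition linv {X : Type} (a : X * bool) : X * bool := (a.1, ~~ a.2).

Lemma linvK {X : Type} : involutive (@linv X).
Proof. by case=> x b; rewrite /linv /= negbK. Qed.

Section FreeGroup.
Variable X : choiceType.
Implicit Types (a b : X * bool) (s t u : seq (X * bool)).

Definition freely_reduced s := sorted (fun a b => b != linv a) s.

Record free_group := FreeGroup {
  fgword :> seq (X * bool);
  fgword_reduced : freely_reduced fgword }.

HB.instance Definition _ := [isSub for fgword].
HB.instance Definition _ := [Choice of free_group by <:].

Definition push a s :=
  if s is b :: s' then if b == linv a then s' else a :: s else [:: a].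

(* The free reduction of s ++ t, when t is freely reduced. *)
Definition redcat s t := foldr push t s.

Lemma push_reduced a s : freely_reduced s -> freely_reduced (push a s).
Proof.
case: s => [|b s] //= rs; case: eqVneq => [_|ba] /=; last by rewrite ba.
exact: path_sorted rs.
Qed.

Lemma redcat_reduced s t : freely_reduced t -> freely_reduced (redcat s t).
Proof. by move=> rt; elim: s => //= a s; exact: push_reduced. Qed.

Lemma pushK a s : freely_reduced s -> push a (push (linv a) s) = s.
Proof.
case: s => [|b s] /=; first by rewrite eqxx.
rewrite linvK; case: eqVneq => [->|ba _] /=; last by rewrite eqxx.
by case: s => [|c s] //= /andP[/negPf ->].
Qed.

Lemma redcat_push a s t :
  freely_reduced t -> redcat (push a s) t = push a (redcat s t).
Proof.
move=> rt; case: s => [|b s] //=; case: eqVneq => [->|_] //=.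
by rewrite pushK //; exact: redcat_reduced.
Qed.

Lemma redcatA s t u : freely_reduced u ->
  redcat s (redcat t u) = redcat (redcat s t) u.
Proof.
by move=> ru; elim: s => //= a s ->; rewrite redcat_push.
Qed.

Lemma redcats0 s : freely_reduced s -> redcat s [::] = s.
Proof.
elim: s => //= a s IHs ras; rewrite IHs; last exact: path_sorted ras.
by case: s ras {IHs} => [|b s] //= /andP[/negPf ->].
Qed.

Lemma inv_word_reduced s :
  freely_reduced s -> freely_reduced (rev (map linv s)).
Proof.
rewrite /freely_reduced rev_sorted sorted_map; apply: sub_sorted => a b /=.
by apply: contra => /eqP->; rewrite !linvK.
Qed.

Lemma redcatVs s : freely_reduced s -> redcat (rev (map linv s)) s = [::].
Proof.
suff H t u : redcat (rev (map linv t)) (t ++ u) = u.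
  by move=> _; rewrite -[X in redcat _ X]cats0 H.
elim: t u => //= a t IHt u.
by rewrite rev_cons -cats1 /redcat foldr_cat /= linvK eqxx; exact: IHt.
Qed.

Lemma redcatsV s : freely_reduced s -> redcat s (rev (map linv s)) = [::].
Proof.
move=> rs; have := redcatVs (inv_word_reduced rs).
by rewrite map_rev revK -map_comp map_id_in // => a _; exact: linvK.
Qed.

Definition fg1 : free_group := @FreeGroup [::] isT.
Definition fg_mul (s t : free_group) : free_group :=
  FreeGroup (redcat_reduced s (fgword_reduced t)).
Definition fg_inv (s : free_group) : free_group :=
  FreeGroup (inv_word_reduced (fgword_reduced s)).

Lemma fg_mulA : associative fg_mul.
Proof. by move=> s t u; apply/val_inj/redcatA/fgword_reduced. Qed.
Lemma fg_mul1 : left_id fg1 fg_mul.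
Proof. by move=> s; exact/val_inj. Qed.
Lemma fg_mulr1 : right_id fg1 fg_mul.
Proof. by move=> s; apply/val_inj/redcats0/fgword_reduced. Qed.
Lemma fg_mulV : left_inverse fg1 fg_inv fg_mul.
Proof. by move=> s; apply/val_inj/redcatVs/fgword_reduced. Qed.
Lemma fg_mulrV : right_inverse fg1 fg_inv fg_mul.
Proof. by move=> s; apply/val_inj/redcatsV/fgword_reduced. Qed.

HB.instance Definition _ := isGroup.Build free_group
  fg_mulA fg_mul1 fg_mulr1 fg_mulV fg_mulrV.

End FreeGroup.

Section Subgroups.
Variable G : groupType.
Implicit Types (H N : set G) (R : set G).

Definition subgroup H : Prop := group_closed [in H].

Definition normal_subgroup N : Prop :=
  subgroup N /\ forall n g : G, N n -> N (n ^ g)%g.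

Definition normal_closure R : set G :=
  \bigcap_(N in [set N | normal_subgroup N /\ R `<=` N]) N.

Definition right_coset H (g : G) : set G := [set (h * g)%g | h in H].

Definition finite_index H : Prop := finite_set (range (right_coset H)).

Definition Hfi : set (set G) :=
  [set H | [/\ subgroup H, H != setT & finite_index H]].

Definition right_cosets (HH : set (set G)) : set (set G) :=
  [set C | exists2 H, HH H & exists g, C = right_coset H g].

(* Partially ordered by the library's order on set G, which is inclusion. *)
Definition Pfi : set (set G) := right_cosets Hfi.

End Subgroups.

Arguments Hfi G : clear implicits.
Arguments Pfi G : clear implicits.

(* G = < X | R >, up to isomorphism. *)
Definition presented_by (X : choiceType) (R : set (free_group X))
    (G : groupType) : Prop :=
  exists f : {multiplicative free_group X -> G},
    range f = setT /\ f @^-1` [set 1%g] = normal_closure R.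

Section FreeProduct.
Variables G1 G2 : groupType.
Implicit Types (a b : G1) (c d : G2) (s t u : seq (G1 + G2)).

Inductive fp_eq : seq (G1 + G2) -> seq (G1 + G2) -> Prop :=
| fp_refl s : fp_eq s s
| fp_sym s t : fp_eq s t -> fp_eq t s
| fp_trans s t u : fp_eq s t -> fp_eq t u -> fp_eq s u
| fp_one1 s t : fp_eq (s ++ inl 1%g :: t) (s ++ t)
| fp_one2 s t : fp_eq (s ++ inr 1%g :: t) (s ++ t)
| fp_mul1 s a b t :
    fp_eq (s ++ inl a :: inl b :: t) (s ++ inl (a * b)%g :: t)
| fp_mul2 s c d t :
    fp_eq (s ++ inr c :: inr d :: t) (s ++ inr (c * d)%g :: t).

Lemma fp_eq_cat s s' t t' :
  fp_eq s s' -> fp_eq t t' -> fp_eq (s ++ t) (s' ++ t').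
Proof.
move=> ss' tt'; apply: (@fp_trans _ (s' ++ t)).
  elim: ss' => {s s'} [s|s s' _|s1 s2 s3 _ h12 _|s r|s r|s a b r|s c d r].
  - exact: fp_refl.
  - exact: fp_sym.
  - exact: fp_trans.
  - by rewrite -!catA; exact: fp_one1.
  - by rewrite -!catA; exact: fp_one2.
  - by rewrite -!catA; exact: fp_mul1.
  - by rewrite -!catA; exact: fp_mul2.
elim: tt' => {t t'} [t|t t' _|t1 t2 t3 _ h12 _|t r|t r|t a b r|t c d r].
- exact: fp_refl.
- exact: fp_sym.
- exact: fp_trans.
- by rewrite !catA; exact: fp_one1.
- by rewrite !catA; exact: fp_one2.
- by rewrite !catA; exact: fp_mul1.
- by rewrite !catA; exact: fp_mul2.
Qed.

Definition fp_linv (x : G1 + G2) : G1 + G2 :=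
  match x with inl a => inl a^-1%g | inr c => inr c^-1%g end.

Definition fp_winv s := rev (map fp_linv s).

Lemma fp_winvK : involutive fp_winv.
Proof.
move=> s; rewrite /fp_winv map_rev revK -map_comp map_id_in //.
by case=> [a|c] _; rewrite /= invgK.
Qed.

Lemma fp_winv_cat s t : fp_winv (s ++ t) = fp_winv t ++ fp_winv s.
Proof. by rewrite /fp_winv map_cat rev_cat. Qed.

Lemma fp_winv_cons x s : fp_winv (x :: s) = fp_winv s ++ [:: fp_linv x].
Proof. by rewrite /fp_winv /= rev_cons -cats1. Qed.

Lemma fp_eq_winv s t : fp_eq s t -> fp_eq (fp_winv s) (fp_winv t).
Proof.
elim=> {s t} [s|s t _|s t u _ st _|s t|s t|s a b t|s c d t].
- exact: fp_refl.
- exact: fp_sym.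
- exact: fp_trans.
- rewrite !fp_winv_cat fp_winv_cons /= invg1 -catA /=; exact: fp_one1.
- rewrite !fp_winv_cat fp_winv_cons /= invg1 -catA /=; exact: fp_one2.
- by rewrite !fp_winv_cat !fp_winv_cons /= invgM -!catA; exact: fp_mul1.
- by rewrite !fp_winv_cat !fp_winv_cons /= invgM -!catA; exact: fp_mul2.
Qed.

Lemma fp_eq_winvl s : fp_eq (fp_winv s ++ s) [::].
Proof.
elim: s => [|x s IHs]; first exact: fp_refl.
rewrite fp_winv_cons -catA /=; apply: fp_trans IHs.
case: x => [a|c] /=.
  by apply: fp_trans (fp_mul1 _ _ _ _) _; rewrite mulVg; exact: fp_one1.
by apply: fp_trans (fp_mul2 _ _ _ _) _; rewrite mulVg; exact: fp_one2.
Qed.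

Definition fp_eqb : rel (seq (G1 + G2)) := fun s t => `[< fp_eq s t >].

Lemma fp_eqb_refl : reflexive fp_eqb.
Proof. by move=> s; apply/asboolP; exact: fp_refl. Qed.
Lemma fp_eqb_sym : symmetric fp_eqb.
Proof. by move=> s t; apply/asboolP/asboolP; exact: fp_sym. Qed.
Lemma fp_eqb_trans : transitive fp_eqb.
Proof.
by move=> t s u /asboolP st /asboolP tu; apply/asboolP/(fp_trans st tu).
Qed.

Canonical fp_equiv := EquivRel fp_eqb fp_eqb_refl fp_eqb_sym fp_eqb_trans.

Definition free_product := {eq_quot fp_equiv}.
HB.instance Definition _ := Choice.on free_product.
HB.instance Definition _ := Quotient.on free_product.

Lemma fp_piP s t :
  reflect (fp_eq s t) (\pi_free_product s == \pi_free_product t).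
Proof. by rewrite eqmodE; exact: asboolP. Qed.

Lemma fp_reprP s : fp_eq (repr (\pi_free_product s)) s.
Proof. by apply/fp_piP; rewrite reprK. Qed.

Definition fp1 : free_product := \pi_free_product [::].
Definition fp_mul (x y : free_product) : free_product :=
  \pi_free_product (repr x ++ repr y).
Definition fp_inv (x : free_product) : free_product :=
  \pi_free_product (fp_winv (repr x)).

Lemma fp_mul_pi s t :
  fp_mul (\pi_free_product s) (\pi_free_product t) = \pi_free_product (s ++ t).
Proof. by apply/eqP/fp_piP/fp_eq_cat; exact: fp_reprP. Qed.

Lemma fp_inv_pi s :
  fp_inv (\pi_free_product s) = \pi_free_product (fp_winv s).
Proof. by apply/eqP/fp_piP/fp_eq_winv; exact: fp_reprP. Qed.

Lemma fp_mulA : associative fp_mul.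
Proof.
move=> x y z; elim/quotW: x => s; elim/quotW: y => t; elim/quotW: z => u.
by rewrite (fp_mul_pi t u) (fp_mul_pi s t) fp_mul_pi fp_mul_pi catA.
Qed.
Lemma fp_mul1g : left_id fp1 fp_mul.
Proof. by move=> x; elim/quotW: x => s; rewrite fp_mul_pi. Qed.
Lemma fp_mulg1 : right_id fp1 fp_mul.
Proof. by move=> x; elim/quotW: x => s; rewrite fp_mul_pi cats0. Qed.
Lemma fp_mulVg : left_inverse fp1 fp_inv fp_mul.
Proof.
move=> x; elim/quotW: x => s; rewrite fp_inv_pi fp_mul_pi.
exact/eqP/fp_piP/fp_eq_winvl.
Qed.
Lemma fp_mulgV : right_inverse fp1 fp_inv fp_mul.
Proof.
move=> x; elim/quotW: x => s; rewrite fp_inv_pi fp_mul_pi; apply/eqP/fp_piP.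
by rewrite -{1}(fp_winvK s); exact: fp_eq_winvl.
Qed.

HB.instance Definition _ := isGroup.Build free_product
  fp_mulA fp_mul1g fp_mulg1 fp_mulVg fp_mulgV.

End FreeProduct.

Section Automorphisms.
Variable G : groupType.

Record aut := Aut {
  aut_fun :> G -> G;
  aut_inv : G -> G;
  autM : {morph aut_fun : x y / (x * y)%g};
  autK : cancel aut_fun aut_inv;
  autVK : cancel aut_inv aut_fun }.

Lemma aut_ext (f g : aut) : f =1 g -> f = g.
Proof.
case: f g => [f f' fM fK f'K] [g g' gM gK g'K] /= /funext fg.
rewrite {}fg in fM fK f'K *; have f'g' : f' = g'.
  by apply/funext => x; rewrite -{1}(g'K x) fK.
rewrite {}f'g' in fK f'K *.
by congr Aut; exact: Prop_irrelevance.
Qed.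

HB.instance Definition _ := gen_eqMixin aut.
HB.instance Definition _ := gen_choiceMixin aut.

Lemma aut_invM (f : aut) : {morph aut_inv f : x y / (x * y)%g}.
Proof.
by move=> x y; rewrite -[RHS](autK f) autM !autVK.
Qed.

Definition aut1 : aut :=
  @Aut id id (fun _ _ => erefl) (fun _ => erefl) (fun _ => erefl).

Lemma aut_compM (f g : aut) : {morph f \o g : x y / (x * y)%g}.
Proof. by move=> x y; rewrite /= !autM. Qed.

Definition aut_mul (f g : aut) : aut :=
  Aut (@aut_compM f g) (can_comp (@autK f) (@autK g))
    (can_comp (@autVK g) (@autVK f)).

Definition aut_invg (f : aut) : aut := Aut (@aut_invM f) (@autVK f) (@autK f).

Lemma aut_mulA : associative aut_mul.
Proof. by move=> f g h; exact: aut_ext. Qed.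
Lemma aut_mul1 : left_id aut1 aut_mul.
Proof. by move=> f; exact: aut_ext. Qed.
Lemma aut_mulr1 : right_id aut1 aut_mul.
Proof. by move=> f; exact: aut_ext. Qed.
Lemma aut_mulV : left_inverse aut1 aut_invg aut_mul.
Proof. by move=> f; apply: aut_ext => x /=; rewrite autK. Qed.
Lemma aut_mulrV : right_inverse aut1 aut_invg aut_mul.
Proof. by move=> f; apply: aut_ext => x /=; rewrite autVK. Qed.

HB.instance Definition _ := isGroup.Build aut
  aut_mulA aut_mul1 aut_mulr1 aut_mulV aut_mulrV.

End Automorphisms.

(* G2 ><| G1, with G2 normal. *)
Record semidirect (G1 G2 : groupType) (phi : {multiplicative G1 -> aut G2}) :=
  Semidirect { sd_normal : G2; sd_top : G1 }.

Arguments semidirect {G1 G2} phi.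

Section SemidirectProduct.
Variables (G1 G2 : groupType) (phi : {multiplicative G1 -> aut G2}).

Local Notation semidirect := (semidirect phi).
Local Notation Semidirect := (Semidirect phi).

HB.instance Definition _ := gen_eqMixin semidirect.
HB.instance Definition _ := gen_choiceMixin semidirect.

Definition sd1 : semidirect := Semidirect 1%g 1%g.
Definition sd_mul (x y : semidirect) : semidirect :=
  Semidirect (sd_normal x * phi (sd_top x) (sd_normal y))%g
    (sd_top x * sd_top y)%g.
Definition sd_inv (x : semidirect) : semidirect :=
  Semidirect (phi (sd_top x)^-1 (sd_normal x)^-1)%g (sd_top x)^-1%g.

Lemma phi1 (n : G2) : phi 1%g n = n.
Proof.
have /(congr1 (fun f : aut G2 => aut_inv (phi 1%g) (f n))) :
    phi 1%g = aut_mul (phi 1%g) (phi 1%g).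
  by rewrite -[LHS](congr1 phi (mulg1 1%g)) gmulfM.
by rewrite /= !autK.
Qed.

Lemma phiM g h (n : G2) : phi (g * h)%g n = phi g (phi h n).
Proof. by rewrite gmulfM. Qed.

Lemma sd_mulA : associative sd_mul.
Proof. by move=> x y z; rewrite /sd_mul /= autM phiM !mulgA. Qed.
Lemma sd_mul1 : left_id sd1 sd_mul.
Proof. by case=> n g; rewrite /sd_mul /= phi1 !mul1g. Qed.
Lemma sd_mulr1 : right_id sd1 sd_mul.
Proof.
case=> n g; rewrite /sd_mul /= !mulg1; congr Semidirect.
suff -> : phi g 1%g = 1%g by rewrite mulg1.
by apply: (@mulgI _ (phi g 1%g)); rewrite -autM !mulg1.
Qed.
Lemma sd_mulV : left_inverse sd1 sd_inv sd_mul.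
Proof.
case=> n g; rewrite /sd_mul /= -autM !mulVg; congr Semidirect.
by apply: (@mulgI _ (phi g^-1%g 1%g)); rewrite -autM !mulg1.
Qed.
Lemma sd_mulrV : right_inverse sd1 sd_inv sd_mul.
Proof. by case=> n g; rewrite /sd_mul /= -phiM mulgV phi1 !mulgV. Qed.

HB.instance Definition _ := isGroup.Build semidirect
  sd_mulA sd_mul1 sd_mulr1 sd_mulV sd_mulrV.

End SemidirectProduct.

Record xgraph (X : Type) := XGraph {
  vertex : Type;
  edge : Type;
  origin : edge -> vertex;
  terminus : edge -> vertex;
  elabel : edge -> X }.

Section XGraph.
Variables (X : choiceType) (Gamma : xgraph X).
Implicit Types (u v : vertex Gamma).

(* Edges of the graph with formal inverses: (e, false) is e, (e, true) is
   e^-1. *)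
Definition hedge := (edge Gamma * bool)%type.
Implicit Types (e : hedge) (p : seq hedge).

Definition hinv e : hedge := (e.1, ~~ e.2).
Definition horigin e := if e.2 then terminus e.1 else origin e.1.
Definition hterminus e := if e.2 then origin e.1 else terminus e.1.
Definition hlabel e : X * bool := (elabel e.1, e.2).

Fixpoint is_path u p v : Prop :=
  if p is e :: p' then horigin e = u /\ is_path (hterminus e) p' v else u = v.

(* The label is the unreduced word read along the path; for a reduced path in
   an X-regular graph it is automatically freely reduced. *)
Definition path_label p : seq (X * bool) := map hlabel p.

Definition reduced_path p : Prop :=
  forall p1 e p2, p <> p1 ++ e :: hinv e :: p2.

Definition xregular : Prop :=
  forall v (a : X * bool), exists! e : hedge, horigin e = v /\ hlabel e = a.

Definition xconnected : Prop := forall u v, exists p, is_path u p v.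

Definition reads u (r : free_group X) v : Prop :=
  exists p, [/\ is_path u p v, reduced_path p & path_label p = r].

Definition fulfills (R : set (free_group X)) : Prop :=
  forall v r u, R r -> reads v r u -> u = v.

End XGraph.

Local Open Scope fset_scope.
Local Open Scope ring_scope.

Record simplicial_complex (V : choiceType) := SimplicialComplex {
  simplex : set {fset V};
  simplex_neq0 : forall s, simplex s -> s != fset0;
  simplex_sub : forall s t, simplex s -> t `<=` s -> t != fset0 -> simplex t }.

Section NerveComplex.
Variables (G : groupType) (HH : set (set G)).

Definition nerve_simplex : set {fset set G} :=
  [set s | [/\ s != fset0, forall C, C \in s -> right_cosets HH C
             & (\bigcap_(C in [set` s]) C) !=set0]]%classic.

Lemma nerve_simplex_neq0 s : nerve_simplex s -> s != fset0.
Proof. by case. Qed.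

Lemma nerve_simplex_sub s t :
  nerve_simplex s -> t `<=` s -> t != fset0 -> nerve_simplex t.
Proof.
move=> [_ sH [x sx]] /fsubsetP ts t0; split=> // [C /ts|]; first exact: sH.
by exists x => C /ts; exact: sx.
Qed.

Definition nerve_complex : simplicial_complex (set G) :=
  SimplicialComplex nerve_simplex_neq0 nerve_simplex_sub.

End NerveComplex.

Section OrderComplex.
Variables (d : Order.disp_t) (T : porderType d) (P : set T).

Definition chain_simplex : set {fset T} :=
  [set s | [/\ s != fset0, forall x, x \in s -> P x
             & {in s &, forall x y, (x >=< y)%O}]]%classic.

Lemma chain_simplex_neq0 s : chain_simplex s -> s != fset0.
Proof. by case. Qed.

Lemma chain_simplex_sub s t :
  chain_simplex s -> t `<=` s -> t != fset0 -> chain_simplex t.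
Proof.
move=> [_ sP sc] /fsubsetP ts t0; split=> // [x /ts|x y /ts xs /ts].
  exact: sP.
exact: sc.
Qed.

Definition order_complex : simplicial_complex T :=
  SimplicialComplex chain_simplex_neq0 chain_simplex_sub.

End OrderComplex.

Section Realization.
Variables (R : realType) (V : choiceType) (K : simplicial_complex V).

Definition bary_in (s : {fset V}) (x : V -> R) : Prop :=
  [/\ forall v, 0 <= x v, forall v, v \notin s -> x v = 0
    & \sum_(v <- s) x v = 1].

Record realization := Realization {
  bary :> V -> R;
  baryP : exists2 s, simplex K s & bary_in s bary }.

HB.instance Definition _ := gen_eqMixin realization.
HB.instance Definition _ := gen_choiceMixin realization.

(* The weak topology: A is open iff its trace on each closed simplex |s| is
   open for the Euclidean topology of |s|. *)
Definition weak_open : set_system realization :=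
  [set A | forall s, simplex K s -> forall x : realization, A x -> bary_in s x ->
    exists2 e : R, 0 < e & forall y : realization, bary_in s y ->
      (forall v, v \in s -> `|x v - y v| < e) -> A y]%classic.

Lemma weak_openT : weak_open setT.
Proof. by move=> s _ x _ _; exists 1. Qed.

Lemma weak_openI : setI_closed weak_open.
Proof.
move=> A B oA oB s Ks x [Ax Bx] sx.
have [e1 e10 h1] := oA s Ks x Ax sx; have [e2 e20 h2] := oB s Ks x Bx sx.
exists (Num.min e1 e2); first by rewrite lt_min e10.
move=> y sy xy; split; [apply: h1 => // | apply: h2 => //] => v vs;
  by have := xy v vs; rewrite lt_min => /andP[].
Qed.

Lemma weak_open_bigU (I : Type) (f : I -> set realization) :
  (forall i, weak_open (f i)) -> weak_open (\bigcup_i f i).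
Proof.
move=> of_ s Ks x [i _ fix_] sx; have [e e0 h] := of_ i s Ks x fix_ sx.
by exists e => // y sy xy; exists i => //; exact: h.
Qed.

HB.instance Definition _ := isOpenTopological.Build realization
  weak_openT weak_openI weak_open_bigU.

End Realization.

Definition contractible (R : realType) (T : topologicalType) : Prop :=
  exists (x0 : T) (h : T * R -> T),
    [/\ {within setT `*` `[0, 1], continuous h}%classic,
        forall x, h (x, 0) = x & forall x, h (x, 1) = x0].

(* Main.v *)
Require Import Defs.
From mathcomp Require Import all_boot all_order all_algebra finmap.
From mathcomp Require Import all_classical all_reals all_analysis.
From mathcomp Require Import ring lra.

Set Implicit Arguments.
Unset Strict Implicit.
Unset Printing Implicit Defensive.

Import Order.TTheory GRing.Theory Num.Theory.
Import numFieldNormedType.Exports.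

(** In Gamma_p the group G1 acts transitively on p points and w acts as a
p-cycle; each of the three groups G maps onto G1. The preimage in G of the
stabilizer of a vertex is therefore a proper subgroup H_p of finite index such
that, for a lift w' of w, H_p contains w'^p and the cosets H_p w'^i cover G
([prime_index_subgroup]).

A coset C of a finite index subgroup is preserved by left multiplication by
some w'^m with m > 0. Let finitely many such cosets share a point g, let m be a
common period, and let p_1, ..., p_k be primes of P not dividing m. Whether
w'^n g lies in H_p depends on n modulo p and some residue works, so the Chinese
remainder theorem gives an n divisible by m with w'^n g in every H_{p_j}; this
point also lies in every C. Hence an H_p with p large is a cone apex over a
given simplex of the nerve complex, and the apices chosen for several simplices
span a simplex together with any common face ([apex_cone]).

This compatibility permits a contraction of the nerve complex by one formula,
for arbitrarily many vertices ([cone_contraction]). For a finite vertex set rho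
with apex a(rho), let e_rho(x) be the mass that the point x puts outside rho.
As t grows, the weight x_v is replaced by max(0, x_v - t), while a(rho)
receives the weight max(0, t - e_rho(x)) times the product of the x_v over rho.
If v is not in rho then x_v <= e_rho(x), so the vertices v that still carry
weight lie in every rho whose apex carries weight, and all of them span a
simplex. After normalization this deforms the identity into the constant map to
the apex of the empty set.

The order complex is a subcomplex of the nerve complex. Conversely, a map in
the manner of a barycentric subdivision sends a simplex of the nerve complex to
the intersection of its cosets, which is again a coset of a finite index
subgroup ([subdivision_map]). The intersection of a chain is its least member,
so on the order complex this map moves every point inside its own simplex and
is homotopic to the identity. The contraction of the nerve complex thus yields
one of the order complex ([order_complex_contraction]).

All these maps are given by normalized weights, finitely many of which are
nonzero on each simplex. [weighted_map] turns such weights into a homotopy that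
is continuous for the product of the weak topology with the real line; its core
is a tube argument ([continuous_prod_realization]). *)

(** * Weak topology of a realization *)

Section Realizations.
Local Open Scope classical_set_scope.
Local Open Scope fset_scope.
Local Open Scope ring_scope.
Variables (R : realType) (V : choiceType) (K : simplicial_complex V).
Implicit Types (x y z : realization R K) (s S : {fset V}) (v : V).

Definition carried S x := forall v, v \notin S -> x v = 0.

Lemma bary_ge0 x v : 0 <= x v.
Proof. by have [s _ []] := baryP x. Qed.

Lemma carrier_ex x : exists2 s, simplex K s & bary_in s x.
Proof. exact: baryP. Qed.

Lemma realization_ext x y : (forall v, x v = y v) -> x = y.
Proof.
case: x y => [x hx] [y hy] /= /funext xy; rewrite {}xy in hx *.
by congr Realization; exact: Prop_irrelevance.
Qed.

Lemma bary_gt0 S x v : carried S x -> 0 < x v -> v \in S.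
Proof. by move=> xS; case: (boolP (v \in S)) => // /xS ->; rewrite ltxx. Qed.

Lemma bary_eq0 x v : ~~ (0 < x v) -> x v = 0.
Proof. by rewrite lt0r bary_ge0 andbT negbK => /eqP. Qed.

Lemma carried_sub S S' x : S `<=` S' -> carried S x -> carried S' x.
Proof. by move=> /fsubsetP SS' xS v vS'; apply: xS; apply: contra vS' => /SS'. Qed.

Lemma bary_sum S x : carried S x -> \sum_(v <- S) x v = 1.
Proof.
have [s _ [_ xs sum1]] := carrier_ex x => xS.
transitivity (\sum_(v <- s `|` S) x v); last first.
  rewrite -sum1; apply/esym; apply: big_fset_incl; first exact: fsubsetUl.
  by move=> v _; exact: xs.
by apply: big_fset_incl; [exact: fsubsetUr|move=> v _; exact: xS].
Qed.

Lemma bary_inE S x : bary_in S x <-> carried S x.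
Proof.
split=> [[]//|xS]; split=> //; first exact: bary_ge0.
exact: bary_sum.
Qed.

Lemma bary_indicator S x v :
  carried S x -> \sum_(u <- S) x u *+ (u == v) = x v.
Proof.
move=> xS; have [vS|vS] := boolP (v \in S).
  rewrite (big_fsetD1 v) //= eqxx big_seq big1 ?addr0 // => u.
  by rewrite !inE => /andP[/negPf ->].
rewrite xS // big_seq big1 // => u uS; case: eqP => // uv.
by rewrite -uv uS in vS.
Qed.

Lemma support_simplex S x : carried S x ->
  simplex K [fset v in S | 0 < x v].
Proof.
move=> xS; have [s Ks [_ xs sum1]] := carrier_ex x.
apply: simplex_sub Ks _ _.
  by apply/fsubsetP => v; rewrite !inE /= => /andP[_]; exact: bary_gt0.
apply/negP => /eqP S0; suff : 1 = 0 :> R by move/eqP; rewrite oner_eq0.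
rewrite -(bary_sum xS) big_seq big1 // => v vS; apply: bary_eq0.
by apply/negP => xv; have := in_fset0 v; rewrite -S0 !inE vS xv.
Qed.

Lemma bary_ex_gt0 x : exists v, 0 < x v.
Proof.
have [s Ks /bary_inE /support_simplex /simplex_neq0 /fset0Pn [v]] := carrier_ex x.
by rewrite !inE /= => /andP[_ ?]; exists v.
Qed.

Lemma realization_of (S : {fset V}) (c : V -> R) : simplex K S ->
  (forall v, 0 <= c v) -> (forall v, v \notin S -> c v = 0) ->
  \sum_(v <- S) c v = 1 -> exists x : realization R K, forall v, x v = c v.
Proof.
move=> KS c0 cS c1.
have cP : exists2 s, simplex K s & bary_in s c by exists S.
by exists (Realization cP).
Qed.

Lemma continuous_bary v : continuous (fun x => x v : R).
Proof.
move=> x; have Fx := nbhs_filter x; apply/cvgrPdist_lt => e e0.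
pose O := [set y : realization R K | `|x v - y v| < e].
suff : open_nbhs x O by move/open_nbhs_nbhs.
split; last by rewrite /O /= subrr normr0.
move=> s Ks y; rewrite /O /= => xy ys.
exists (e - `|x v - y v|); first by rewrite subr_gt0.
move=> z zs yz.
have zy : `|y v - z v| < e - `|x v - y v|.
  case: (boolP (v \in s)) => [/yz //|vs].
  by case: ys zs => _ ys _ [_ zs _]; rewrite zs // {1}ys // subrr normr0 subr_gt0.
have -> : x v - z v = (x v - y v) + (y v - z v) by ring.
by rewrite (le_lt_trans (ler_normD _ _)) // -ltrBrDl.
Qed.

(** A finite subcomplex carries the Euclidean topology, so coordinatewise limits
inside it are limits for the weak topology. Only finitely many faces of [S] and
of the carrier of [z] compete for the radius, and a face that supports [f t]
eventually contains the support of [z]. *)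
Lemma cvg_realization (T : Type) (F : set_system T) (FF : Filter F)
    (f : T -> realization R K) z S :
  (forall v, (fun t => f t v : R) @ F --> z v) ->
  (\forall t \near F, carried S (f t)) -> f @ F --> z.
Proof.
move=> fz fS A; rewrite nbhsE; case=> O [oO Oz] OA.
have [s Ks /bary_inE zs] := carrier_ex z.
pose S' := S `|` s.
have epsP (rho : {fset V}) : exists2 e : R, 0 < e &
    simplex K rho -> carried rho z -> forall y, carried rho y ->
    (forall v, v \in rho -> `|z v - y v| < e) -> O y.
  have [Kr|] := pselect (simplex K rho); last by exists 1.
  have [zr|] := pselect (carried rho z); last by exists 1.
  have [e e0 he] := oO _ Kr _ Oz (proj2 (bary_inE _ _) zr).
  by exists e => // _ _ y /bary_inE yr; exact: he.
pose eps rho := sval (cid2 (epsP rho)).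
have eps_gt0 rho : 0 < eps rho by rewrite /eps; case: cid2.
have epsE rho : simplex K rho -> carried rho z -> forall y, carried rho y ->
    (forall v, v \in rho -> `|z v - y v| < eps rho) -> O y.
  by rewrite /eps; case: cid2.
suff : \forall t \near F, A (f t) by [].
near=> t; apply: OA.
have tS : carried S' (f t).
  by apply: carried_sub (fsubsetUl _ _) _; near: t.
pose rho := [fset v in S' | 0 < f t v].
have Krho : simplex K rho by exact: support_simplex.
have frho : carried rho (f t).
  move=> v; rewrite !inE /= negb_and => /orP[vS'|/bary_eq0//].
  by apply: tS; rewrite inE.
have pos : [set t | forall v, v \in S' -> 0 < z v -> 0 < f t v] t.
  near: t.
  suff : F (\bigcap_(v in [set` S']) [set t | 0 < z v -> 0 < f t v]).
    by apply: filterS => u + v vS'; exact.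
  apply: filter_bigI => v _.
  have [zv|/negP zv] := boolP (0 < z v); last exact: nearW.
  have /cvgrPdist_lt /(_ _ zv) := fz v; apply: filterS => u /=.
  by rewrite ltr_norml => /andP[_]; rewrite ltrBlDr -ltrBlDl subrr.
have cl : [set t | forall rho, rho \in fpowerset S' -> forall v, v \in rho ->
    `|z v - f t v| < eps rho] t.
  near: t.
  suff : F (\bigcap_(r in [set` fpowerset S'])
      \bigcap_(v in [set` r]) [set t | `|z v - f t v| < eps r]).
    by apply: filterS => u + r rS' v vr; exact.
  apply: filter_bigI => r _; apply: filter_bigI => v _.
  by have /cvgrPdist_lt /(_ _ (eps_gt0 r)) := fz v.
apply: (epsE rho) => //.
  move=> v; rewrite !inE /= => vrho; apply: bary_eq0; apply: contra vrho => zv.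
  have vS' : v \in S' by rewrite inE (bary_gt0 zs zv) orbT.
  by have := vS'; rewrite inE => -> /=; exact: pos.
apply: cl; rewrite fpowersetE; apply/fsubsetP => v.
by rewrite !inE /= => /andP[].
Unshelve. all: by end_near. Qed.

(** Weak openness is tested on the first factor alone, although the weak topology
does not commute with products in general: around [t] there is a compact
interval [J] with [{x} * J] in the preimage of an open set, and the set of all
[y] with [{y} * J] in that preimage is weakly open because [J] is compact. *)
Lemma continuous_prod_realization (T : topologicalType)
    (h : realization R K * R -> T) :
  (forall s y t, simplex K s -> carried s y ->
    h @ filter_prod (within (carried s) (nbhs y)) (nbhs t) --> h (y, t)) ->
  continuous h.
Proof.
move=> hs [x t] A; rewrite nbhsE; case=> O [oO Oh] OA.
have [J [Jt cJ JO]] : exists J : set R, [/\ nbhs t J, compact J &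
    forall t', J t' -> O (h (x, t'))].
  have [s Ks /bary_inE xs] := carrier_ex x.
  have [[B C] /= [Bx Ct] BC] := hs s x t Ks xs O (open_nbhs_nbhs (conj oO Oh)).
  have /nbhs_ballP[e /= e0 eC] := Ct.
  exists [set u : R | t - e / 2 <= u <= t + e / 2]%classic; split.
  - apply/nbhs_ballP; exists (e / 2) => /=; first by rewrite divr_gt0.
    move=> u; rewrite /ball /= ltr_norml => /andP[] ? ?.
    by apply/andP; split; lra.
  - rewrite -set_itvcc; exact: segment_compact.
  - move=> u /= /andP[u1 u2]; apply: (BC (x, u)).
    split; first exact: (nbhs_singleton Bx).
    by apply: eC; rewrite /ball /= ltr_norml; apply/andP; split; lra.
pose U := [set y | forall t', J t' -> O (h (y, t'))].
exists (U, J) => [|[y t'] /= [Uy Jt']]; last exact/OA/Uy.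
split=> //=; apply: open_nbhs_nbhs; split=> //.
move=> s Ks y Uy /bary_inE ys.
have : \forall y' \near within (carried s) (nbhs y),
    (J `<=` (fun t' => O (h (y', t'))))%classic.
  apply: (proj1 (compact_near_coveringP J) cJ _ _ (fun y' t' => O (h (y', t')))).
  move=> t' Jt'; have := hs s y t' Ks ys O (open_nbhs_nbhs (conj oO (Uy _ Jt'))).
  case; case=> B C /= [By Ct'] BC; exists (C, B) => //.
  by move=> [a b] /= [Ca Bb]; exact: (BC (b, a)).
rewrite /within /= nbhsE; case=> W [oW Wy] WU.
have [e e0 eW] := oW s Ks y Wy (proj2 (bary_inE _ _) ys).
exists e => // z /bary_inE zs yz.
by apply: WU => //; apply: eW => //; apply/bary_inE.
Qed.

End Realizations.

(** * Maps given by weights *)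

Section WeightedMap.
Local Open Scope fset_scope.
Local Open Scope ring_scope.
Variables (R : realType) (V V' : choiceType).
Variables (K : simplicial_complex V) (L : simplicial_complex V').
Variables (I : choiceType) (phi : I -> V') (g : I -> realization R K * R -> R).

(** The normalized image of the weights under [phi], computed in any finite set
[tau] outside which the weights vanish at [z]. *)
Definition weight_at (tau : {fset I}) (z : realization R K * R) (v : V') : R :=
  (\sum_(i <- tau) g i z *+ (phi i == v)) / \sum_(i <- tau) g i z.

Hypothesis g_cont : forall i, continuous (g i).
Hypothesis g_ge0 : forall i z, 0 <= g i z.
Hypothesis g_finite : forall s : {fset V}, exists tau : {fset I},
  forall i z, carried s z.1 -> i \notin tau -> g i z = 0.
Hypothesis g_gt0 : forall z, exists i, 0 < g i z.
Hypothesis g_simplex : forall z,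
  exists2 s, simplex L s & forall i, 0 < g i z -> phi i \in s.

Lemma weight_total_gt0 (tau : {fset I}) z :
  (forall i, i \notin tau -> g i z = 0) -> 0 < \sum_(i <- tau) g i z.
Proof.
move=> tauP; have [i gi] := g_gt0 z.
have itau : i \in tau by apply: contraLR gi => /tauP ->; rewrite ltxx.
rewrite (big_fsetD1 i) //= ltr_wpDr //; apply: sumr_ge0 => j _; exact: g_ge0.
Qed.

Lemma weight_at_simplex (tau : {fset I}) (z : realization R K * R) :
  (forall i, i \notin tau -> g i z = 0) ->
  exists y : realization R L, forall v, y v = weight_at tau z v.
Proof.
move=> tauP; have tot := weight_total_gt0 tauP.
have [s Ls gs] := g_simplex z.
have g0 i : phi i \notin s -> g i z = 0.
  by move=> /negP pi; apply/eqP; apply/negPn/negP => gi; apply: pi; apply: gs;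
     rewrite lt0r gi g_ge0.
apply: (realization_of Ls) => [v|v vs|].
- by apply: divr_ge0 (ltW tot); apply: sumr_ge0 => i _; rewrite mulrn_wge0.
- rewrite /weight_at big1 ?mul0r // => i _; case: eqP => // iv.
  by rewrite g0 // iv.
- rewrite -mulr_suml exchange_big /= -[RHS](divff (lt0r_neq0 tot)).
  congr (_ / _); apply: eq_bigr => i _.
  have [si|si] := boolP (phi i \in s); last by rewrite big1 ?g0 // => v _; rewrite mul0rn.
  rewrite (big_fsetD1 (phi i)) //= eqxx mulr1n big_seq big1 ?addr0 // => v.
  by rewrite !inE eq_sym => /andP[/negPf ->].
Qed.

Lemma weight_at_incl (tau tau' : {fset I}) z v :
  (forall i, i \notin tau -> g i z = 0) ->
  (forall i, i \notin tau' -> g i z = 0) ->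
  weight_at tau z v = weight_at tau' z v.
Proof.
suff H (s s' : {fset I}) : s `<=` s' -> (forall i, i \notin s -> g i z = 0) ->
    weight_at s z v = weight_at s' z v.
  move=> t0 t0'; rewrite (H tau (tau `|` tau')) ?fsubsetUl //.
  by rewrite -(H tau' (tau `|` tau')) ?fsubsetUr.
move=> ss' s0; rewrite /weight_at.
by congr (_ / _); apply: big_fset_incl => // i _ /s0 ->; rewrite ?mul0rn.
Qed.

(** On a fixed simplex only the indices in a finite set [tau] matter, so there the
coordinates are quotients of finite sums of continuous functions. The tube
argument asks for continuity on each simplex times the line only, so the total
weight, an infinite sum in general, need not be treated globally. *)
Lemma weighted_map : exists h : realization R K * R -> realization R L,
  continuous h /\ forall z tau, (forall i, i \notin tau -> g i z = 0) ->
    forall v, h z v = weight_at tau z v.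
Proof.
have hP z : exists y : realization R L, forall tau,
    (forall i, i \notin tau -> g i z = 0) -> forall v, y v = weight_at tau z v.
  have [s _ /bary_inE zs] := carrier_ex z.1.
  have [tau tauP] := g_finite s.
  have tau0 i : i \notin tau -> g i z = 0 by exact: tauP.
  have [y yE] := weight_at_simplex tau0; exists y => tau' tau'0 v.
  by rewrite yE; exact: weight_at_incl.
have [h hE] := choice hP; exists h; split=> //.
apply: continuous_prod_realization => s y t Ks ys.
have [tau tauP] := g_finite s.
set F := filter_prod _ _.
have FF : Filter F by exact: filter_prod_filter.
have Fs : \forall z \near F, carried s z.1.
  exists (carried s, setT); [split; [exact: withinT|exact: filterT]|by case=> a b []].
have FE : \forall z \near F, forall v, weight_at tau z v = h z v.
  by apply: filterS Fs => z zs v; rewrite (hE z tau) // => i; exact: tauP.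
have Fg i : (g i z @[z --> F] --> g i (y, t))%classic.
  move=> A /(@g_cont i (y, t)) [[B C] /= [By Ct] BC]; exists (B, C) => //; split=> //=.
  exact: (cvg_within (F := nbhs y)).
have tau0 i : i \notin tau -> g i (y, t) = 0 by exact: tauP.
apply: (@cvg_realization _ _ _ _ _ _ _ _ [fset phi i | i in tau]) => [v|].
  have Fv : {near F, (fun z => weight_at tau z v) =1 (fun z => h z v : R)}.
    by apply: filterS FE => z ->.
  apply: cvg_trans (near_eq_cvg Fv) _.
  rewrite (hE _ tau) //; apply: cvgM; last first.
    apply: cvgV; first by rewrite gt_eqF // weight_total_gt0.
    by apply: cvg_big => [|i _]; [exact: add_continuous|exact: Fg].
  apply: cvg_big => [|i _]; first exact: add_continuous.
  by case: eqP => _; [exact: Fg|exact: cvg_cst].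
apply: filterS FE => z zE v; rewrite -zE => /imfsetP vtau.
rewrite /weight_at big_seq big1 ?mul0r // => i itau; case: eqP => // iv.
by case: vtau; exists i.
Qed.

End WeightedMap.

(** * Contraction along coherent cone apices *)

Section ContinuousReal.
Local Open Scope ring_scope.
Variables (R : realType) (T : topologicalType).
Implicit Types f g : T -> R.

Lemma continuous_subr f g :
  continuous f -> continuous g -> continuous (fun z => f z - g z).
Proof. by move=> fc gc z; apply: cvgB; [exact: fc|exact: gc]. Qed.

Lemma continuous_mulr f g :
  continuous f -> continuous g -> continuous (fun z => f z * g z).
Proof. by move=> fc gc z; apply: cvgM; [exact: fc|exact: gc]. Qed.

Lemma continuous_maxr f g :
  continuous f -> continuous g -> continuous (fun z => Num.max (f z) (g z)).
Proof.
move=> fc gc z; apply: continuous2_cvg; [|exact: fc|exact: gc].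
exact: (@max_continuous _ R (f z, g z)).
Qed.

Lemma continuous_minr f g :
  continuous f -> continuous g -> continuous (fun z => Num.min (f z) (g z)).
Proof.
move=> fc gc z; apply: continuous2_cvg; [|exact: fc|exact: gc].
exact: (@min_continuous _ R (f z, g z)).
Qed.

Lemma continuous_sumr (I : Type) (r : seq I) (f : I -> T -> R) :
  (forall i, continuous (f i)) -> continuous (fun z => \sum_(i <- r) f i z).
Proof.
move=> fc z; apply: cvg_big => [|i _]; [exact: add_continuous|exact: fc].
Qed.

Lemma continuous_prodr (I : Type) (r : seq I) (f : I -> T -> R) :
  (forall i, continuous (f i)) -> continuous (fun z => \prod_(i <- r) f i z).
Proof.
move=> fc z; apply: cvg_big => [|i _]; [exact: mul_continuous|exact: fc].
Qed.

End ContinuousReal.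

Section ConeContraction.
Local Open Scope fset_scope.
Local Open Scope ring_scope.
Variables (R : realType) (V : choiceType) (K : simplicial_complex V).
Implicit Types (x : realization R K) (s S rho : {fset V}) (z : realization R K * R).

Definition outside rho (c : V -> R) : R := 1 - \sum_(v <- rho) c v.

Lemma sum_bary_le1 rho x : \sum_(v <- rho) x v <= 1.
Proof.
have [s _ /bary_inE xs] := carrier_ex x.
have xs' : carried (s `|` rho) x by apply: carried_sub xs; exact: fsubsetUl.
rewrite -(bary_sum xs').
rewrite [X in X <= _](_ : _ = \sum_(v <- rho) (if v \in rho then x v else 0)).
  rewrite (big_fset_incl _ (fsubsetUr s rho)) => [|v _ /negPf -> //].
  by apply: ler_sum => v _; case: ifP => // _; exact: bary_ge0.
by rewrite [LHS]big_seq [RHS]big_seq; apply: eq_bigr => v ->.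
Qed.

Lemma outside_ge0 rho x : 0 <= outside rho x.
Proof. by rewrite subr_ge0 sum_bary_le1. Qed.

(** The inequality behind both homotopies: a vertex missing from [rho] is itself
part of the mass outside [rho]. *)
Lemma le_outside rho x v : v \notin rho -> x v <= outside rho x.
Proof.
move=> vr; have := sum_bary_le1 (v |` rho) x.
by rewrite big_fsetU1 //= -lerBrDr.
Qed.

Lemma outside_carried rho x : carried rho x -> outside rho x = 0.
Proof. by move=> xr; rewrite /outside bary_sum // subrr. Qed.

Lemma continuous_coord v : continuous (fun z => z.1 v : R).
Proof.
move=> z; apply: (@continuous_comp _ _ _ fst (fun x => x v : R)).
  exact: cvg_fst.
exact: continuous_bary.
Qed.

Lemma continuous_outside rho : continuous (fun z => outside rho z.1).
Proof.
apply: continuous_subr; first exact: cst_continuous.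
by apply: continuous_sumr => v; exact: continuous_coord.
Qed.

(** The homotopies are written on the whole line, with time cut off to the unit
interval, so that their weights are nonnegative for every real time. *)
Definition clamp (t : R) : R := Num.max 0 (Num.min 1 t).

Lemma clamp_ge0 t : 0 <= clamp t.
Proof. by rewrite /clamp le_max lexx. Qed.
Lemma clamp_le1 t : clamp t <= 1.
Proof. by rewrite /clamp ge_max ler01 ge_min lexx. Qed.
Lemma clamp0 : clamp 0 = 0.
Proof. by rewrite /clamp min_r ?ler01 // maxxx. Qed.
Lemma clamp1 : clamp 1 = 1.
Proof. by rewrite /clamp minxx max_r ?ler01. Qed.

Lemma continuous_clamp : continuous (fun z => clamp z.2).
Proof.
apply: continuous_maxr; first exact: cst_continuous.
apply: continuous_minr; first exact: cst_continuous.
by move=> z; exact: cvg_snd.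
Qed.

(** [a] chooses apices coherently: the apices of finitely many sets that all
contain the face [S] span a simplex with [S]. The empty [S] makes any finitely
many apices span a simplex. *)
Definition cone_apex (a : {fset V} -> V) := forall (S : {fset V}) (Q : {fset {fset V}}),
  S = fset0 \/ simplex K S -> (forall rho, rho \in Q -> S `<=` rho) ->
  S `|` [fset a rho | rho in Q] != fset0 ->
  simplex K (S `|` [fset a rho | rho in Q]).

Variable a : {fset V} -> V.
Hypothesis aP : cone_apex a.

Definition cone_vertex (i : V + {fset V}) : V :=
  match i with inl v => v | inr rho => a rho end.

(** Time runs twice as fast as [z.2]: from time 1/2 on no vertex keeps its own
weight, and the set [fset0], outside which the whole mass 1 lies, starts to
contribute. The factor [1 - clamp z.2] removes all other apices at time 1. The
product over [rho] confines [rho] to the support of the point. *)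
Definition cone_weight (i : V + {fset V}) z : R :=
  match i with
  | inl v => Num.max 0 (z.1 v - 2 * clamp z.2)
  | inr rho => (if rho == fset0 then 1 else 1 - clamp z.2) *
      (\prod_(v <- rho) z.1 v * Num.max 0 (2 * clamp z.2 - outside rho z.1))
  end.

Lemma cone_weight_cont i : continuous (cone_weight i).
Proof.
have c2 : continuous (fun z => 2 * clamp z.2).
  by apply: continuous_mulr; [exact: cst_continuous|exact: continuous_clamp].
case: i => [v|rho] /=.
  apply: continuous_maxr; first exact: cst_continuous.
  by apply: continuous_subr => //; exact: continuous_coord.
apply: continuous_mulr.
  case: eqP => _; first exact: cst_continuous.
  by apply: continuous_subr; [exact: cst_continuous|exact: continuous_clamp].
apply: continuous_mulr.
  by apply: continuous_prodr => v; exact: continuous_coord.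
apply: continuous_maxr; first exact: cst_continuous.
by apply: continuous_subr => //; exact: continuous_outside.
Qed.

Lemma cone_weight_ge0 i z : 0 <= cone_weight i z.
Proof.
case: i => [v|rho] /=; first by rewrite le_max lexx.
apply: mulr_ge0; first by case: eqP => // _; rewrite subr_ge0 clamp_le1.
by apply: mulr_ge0; [apply: prodr_ge0 => v _; exact: bary_ge0|rewrite le_max lexx].
Qed.

Lemma prod_bary_eq0 s rho x : carried s x -> ~~ (rho `<=` s) ->
  \prod_(v <- rho) x v = 0.
Proof.
move=> xs /fsubsetPn [v vr vs]; by rewrite (big_fsetD1 v) //= xs // mul0r.
Qed.

Definition cone_indices s : {fset V + {fset V}} :=
  [fset inl v | v in s] `|` [fset inr rho | rho in fpowerset s].

Lemma cone_weight_eq0 s i z :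
  carried s z.1 -> i \notin cone_indices s -> cone_weight i z = 0.
Proof.
move=> zs; rewrite !inE negb_or; case: i => [v|rho] /andP[h1 h2] /=.
  have vs : v \notin s by apply: contra h1 => vs; apply/imfsetP; exists v.
  by rewrite zs // max_l // sub0r oppr_le0 mulr_ge0 // clamp_ge0.
rewrite (@prod_bary_eq0 s) ?mul0r ?mulr0 //.
by apply: contra h2 => vs; apply/imfsetP; exists rho => //=; rewrite fpowersetE.
Qed.

Lemma cone_weight_finite s : exists tau : {fset V + {fset V}},
  forall i z, carried s z.1 -> i \notin tau -> cone_weight i z = 0.
Proof. by exists (cone_indices s) => i z; exact: cone_weight_eq0. Qed.

Lemma cone_weight_gt0 z : exists i, 0 < cone_weight i z.
Proof.
have [t1|t1] := ltP (clamp z.2) 1; last first.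
  exists (inr fset0) => /=; rewrite ?eqxx mul1r big_seq_fset0 mul1r lt_max.
  apply/orP; right; rewrite /outside big_seq_fset0 subr0 subr_gt0.
  by apply: lt_le_trans (_ : 2 * 1 <= _); [rewrite mulr1 ltr1n|rewrite ler_pM2l].
have [t0|t0] := ltP 0 (clamp z.2); last first.
  have [v zv] := bary_ex_gt0 z.1; exists (inl v) => /=; rewrite lt_max.
  by apply/orP; right; rewrite subr_gt0 (le_lt_trans _ zv) // pmulr_rle0.
have [s Ks /bary_inE zs] := carrier_ex z.1.
have := simplex_neq0 (support_simplex zs); set r := [fset v in s | _] => r0.
have zr : carried r z.1.
  move=> v; rewrite !inE negb_and => /orP[/zs//|]; exact: bary_eq0.
exists (inr r) => /=; rewrite (negPf r0) mulr_gt0 ?subr_gt0 // mulr_gt0 //.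
  by rewrite big_seq prodr_gt0 // => v; rewrite !inE => /andP[].
by rewrite outside_carried // subr0 lt_max mulr_gt0 // orbT.
Qed.

(** If [rho] has positive weight at time [t] then the mass outside [rho] is below
[2 * t], so [rho] contains every vertex whose weight still exceeds [2 * t]. *)
Lemma cone_weight_simplex z : exists2 s, simplex K s &
  forall i, 0 < cone_weight i z -> cone_vertex i \in s.
Proof.
have [s Ks /bary_inE zs] := carrier_ex z.1.
pose S := [fset v in s | 0 < cone_weight (inl v) z].
pose Q := [fset rho in fpowerset s | 0 < cone_weight (inr rho) z].
have SQ i : 0 < cone_weight i z -> cone_vertex i \in S `|` [fset a rho | rho in Q].
  move=> iz; have : i \in cone_indices s.
    by apply: contraLR iz => /(cone_weight_eq0 zs) ->; rewrite ltxx.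
  rewrite !inE => /orP[/imfsetP[v /= vs ei]|/imfsetP[rho /= rs ei]].
    by move: iz; rewrite ei /= => ->; rewrite vs.
  rewrite ei /=; apply/orP; right; apply/imfsetP; exists rho => //=.
  by rewrite !inE rs -ei.
exists (S `|` [fset a rho | rho in Q]) => //; apply: aP.
- have [->|S0] := eqVneq S fset0; [by left|right].
  by apply: simplex_sub Ks _ S0; apply/fsubsetP => v; rewrite !inE => /andP[].
- move=> rho; rewrite !inE => /andP[_ rz]; apply/fsubsetP => v.
  rewrite !inE => /andP[_]; rewrite lt_max ltxx /= => vz.
  apply: contraLR rz => vr; rewrite -leNgt /= max_l ?mulr0 //.
  rewrite subr_le0 (le_trans _ (le_outside _ vr)) // ltW // -subr_gt0.
  by move: vz; rewrite subr_gt0.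
- by have [i /SQ iz] := cone_weight_gt0 z; apply/fset0Pn; exists (cone_vertex i).
Qed.

(** At time 0 only the vertices of the point carry weight, at time 1 only the apex
of [fset0]. *)
Lemma cone_contraction : exists x0 (h : realization R K * R -> realization R K),
  [/\ continuous h, forall x, h (x, 0) = x & forall x, h (x, 1) = x0].
Proof.
have [h [hc hE]] := weighted_map cone_weight_cont cone_weight_ge0
  cone_weight_finite cone_weight_gt0 cone_weight_simplex.
have apex : simplex K [fset a fset0].
  have := @aP fset0 [fset fset0]; rewrite fset0U imfset_fset1; apply.
  - by left.
  - by move=> rho _; exact: fsub0set.
  - by apply/fset0Pn; exists (a fset0); rewrite inE.
have [x0 x0E] : exists x0 : realization R K, forall v, x0 v = (a fset0 == v)%:R.
  apply: (realization_of apex) => [v|v|]; first by rewrite ler0n.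
    by rewrite inE eq_sym => /negPf ->.
  by rewrite big_seq_fset1 eqxx.
exists x0, h; split=> // x; apply: realization_ext => v.
  have [s Ks /bary_inE xs] := carrier_ex x.
  rewrite (hE _ [fset inl v | v in s]).
    rewrite /weight_at !big_imfset /=; try by move=> ? ? _ _ [].
    rewrite clamp0 mulr0; under eq_bigr do rewrite subr0 max_r ?bary_ge0 //.
    under [X in _ / X]eq_bigr do rewrite subr0 max_r ?bary_ge0 //.
    by rewrite (bary_sum xs) divr1 bary_indicator.
  move=> i; case: (boolP (i \in cone_indices s)); last first.
    by move=> + _; exact: (@cone_weight_eq0 s _ (x, 0)).
  rewrite !inE => /orP[-> //|/imfsetP[rho _ ->]] _ /=.
  by rewrite clamp0 mulr0 max_l ?mulr0 // sub0r oppr_le0 outside_ge0.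
rewrite x0E (hE _ [fset inr fset0]).
  rewrite /weight_at !big_seq_fset1 /= ?eqxx clamp1 big_seq_fset0 !mul1r.
  rewrite /outside big_seq_fset0 subr0 mulr1 max_r ?subr_ge0 ?ler1n //.
  have -> : 2 - 1 = 1 :> R by ring.
  by rewrite divr1.
move=> [u|rho]; rewrite !inE /=.
  move=> _; rewrite clamp1 max_l // mulr1 subr_le0.
  have := @le_outside fset0 x u; rewrite in_fset0 /outside big_seq_fset0 subr0.
  by move=> /(_ isT) h1; apply: le_trans h1 _; rewrite ler1n.
have -> : (inr rho == inr fset0 :> V + {fset V}) = (rho == fset0) by [].
by move=> /negPf ->; rewrite clamp1 subrr mul0r.
Qed.

End ConeContraction.

(** * Concatenation of homotopies *)

Section Homotopies.
Local Open Scope ring_scope.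
Variables (R : realType) (T U : topologicalType).

Lemma glue_homotopies (f g : T * R -> U) :
  continuous f -> continuous g -> (forall x, f (x, 1) = g (x, 0)) ->
  exists h : T * R -> U,
    [/\ continuous h, forall x, h (x, 0) = f (x, 0) & forall x, h (x, 1) = g (x, 1)].
Proof.
move=> fc gc fg.
pose f' z := f (z.1, 2 * z.2); pose g' z := g (z.1, 2 * z.2 - 1).
have sc : continuous (fun z : T * R => 2 * z.2).
  by apply: continuous_mulr; [exact: cst_continuous|move=> z; exact: cvg_snd].
have pc (u : T * R -> R) : continuous u -> continuous (fun z => (z.1, u z) : T * R).
  by move=> uc z; apply: (@cvg_pair _ _ _ _ (nbhs z.1) (nbhs (u z))); [exact: cvg_fst|exact: uc].
have f'c : continuous f'.
  move=> z; exact: (@continuous_comp _ _ _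
    (fun z : T * R => (z.1, 2 * z.2) : T * R) f z (pc _ sc z) (fc _)).
have g'c : continuous g'.
  have sc1 : continuous (fun z : T * R => 2 * z.2 - 1).
    by apply: continuous_subr => //; exact: cst_continuous.
  move=> z; exact: (@continuous_comp _ _ _
    (fun z : T * R => (z.1, 2 * z.2 - 1) : T * R) g z (pc _ sc1 z) (gc _)).
pose h (z : T * R) := if 2 * z.2 <= 1 then f' z else g' z.
exists h; split=> [|x|x]; last 2 first.
- by rewrite /h /f' /= mulr0 ler01.
- by rewrite /h /g' /= mulr1 ifF ?lt_geF ?ltr1n //; congr (g (_, _)); ring.
have cA : closed [set z : T * R | 2 * z.2 <= 1]%classic.
  by apply: (preimage_closed _ (@closed_le R 1)) => z _; exact: sc.
have cB : closed [set z : T * R | 1 <= 2 * z.2]%classic.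
  by apply: (preimage_closed _ (@closed_ge R 1)) => z _; exact: sc.
apply/continuous_closedP => W cW.
rewrite (_ : h @^-1` W = ([set z | 2 * z.2 <= 1] `&` f' @^-1` W) `|`
    ([set z | 1 <= 2 * z.2] `&` g' @^-1` W))%classic.
  by apply: closedU; apply: closedI => //; apply: preimage_closed.
apply/seteqP; split=> [z|z]; rewrite /h /=.
  by case: ifPn => [zle|]; [left|rewrite -ltNge => /ltW; right].
case=> -[z1 Wz]; first by rewrite z1.
have [zle|//] := boolP (2 * z.2 <= 1).
have z2 : 2 * z.2 = 1 by apply/le_anti/andP.
by rewrite /f' z2 fg; move: Wz; rewrite /g' z2 subrr.
Qed.
End Homotopies.

(** * Order complexes *)

Section SubdivisionWeight.
Local Open Scope fset_scope.
Local Open Scope ring_scope.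
Variables (R : realType) (V : choiceType).
Implicit Types (rho : {fset V}) (c : V -> R).

(** Positive exactly when [rho] is nonempty and each coordinate in [rho] exceeds
the total mass outside [rho]. Normalized, these weights play the role of the
barycentric coordinates of the first subdivision; unlike those they need no
ordering of the coordinates. *)
Definition face_weight rho c : R :=
  if rho == fset0 then 0 else \prod_(v <- rho) Num.max 0 (c v - outside rho c).

Lemma face_weight_ge0 rho c : 0 <= face_weight rho c.
Proof.
rewrite /face_weight; case: eqP => // _.
by apply: prodr_ge0 => v _; rewrite le_max lexx.
Qed.

Lemma face_weight_gt0 rho c v :
  0 < face_weight rho c -> v \in rho -> outside rho c < c v.
Proof.
rewrite /face_weight; case: eqP => [_|_]; first by rewrite ltxx.
move=> + vr; apply: contraLR; rewrite -!leNgt => cv.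
by rewrite (big_fsetD1 v) //= max_l ?mul0r // subr_le0.
Qed.

Variable K : simplicial_complex V.
Implicit Types (x : realization R K) (z : realization R K * R).

Lemma continuous_face_weight rho : continuous (fun z => face_weight rho z.1).
Proof.
rewrite /face_weight; case: eqP => _; first exact: cst_continuous.
apply: continuous_prodr => v; apply: continuous_maxr; first exact: cst_continuous.
by apply: continuous_subr; [exact: continuous_coord|exact: continuous_outside].
Qed.

Lemma face_weight_sub (s : {fset V}) rho x :
  carried s x -> 0 < face_weight rho x -> rho `<=` s.
Proof.
move=> xs rx; apply/fsubsetP => v vr; apply: (bary_gt0 xs).
exact: le_lt_trans (outside_ge0 _ _) (face_weight_gt0 rx vr).
Qed.

Lemma face_weight_neq0 rho c : 0 < face_weight rho c -> rho != fset0.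
Proof. by rewrite /face_weight; case: eqP => //; rewrite ltxx. Qed.

(** Vertices [v] in [rho] only and [u] in [rho'] only would have to satisfy both
[x u < x v] and [x v < x u]. *)
Lemma face_weight_chain rho rho' x :
  0 < face_weight rho x -> 0 < face_weight rho' x ->
  (rho `<=` rho') || (rho' `<=` rho).
Proof.
move=> rx r'x; have [//|/fsubsetPn[v vr vr']] := boolP (rho `<=` rho').
apply/fsubsetP => u ur'; apply/negPn/negP => ur.
have := lt_le_trans (face_weight_gt0 rx vr) (le_outside _ vr').
rewrite ltNge => /negP; apply; apply: le_trans (le_outside _ ur).
exact/ltW/face_weight_gt0.
Qed.

(** The whole support works: no mass lies outside it. *)
Lemma face_weight_ex x : exists rho, 0 < face_weight rho x.
Proof.
have [s _ /bary_inE xs] := carrier_ex x.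
have := simplex_neq0 (support_simplex xs); set r := [fset v in s | _] => r0.
have xr : carried r x.
  by move=> v; rewrite !inE negb_and => /orP[/xs//|]; exact: bary_eq0.
exists r; rewrite /face_weight (negPf r0) big_seq prodr_gt0 // => v.
by rewrite !inE outside_carried // subr0 lt_max => /andP[_ ->]; rewrite orbT.
Qed.

Lemma face_weight_eq0 s rho x :
  carried s x -> rho \notin fpowerset s -> face_weight rho x = 0.
Proof.
move=> xs; rewrite fpowersetE => rs; apply/eqP/negPn/negP => r0.
by move/negP: rs; apply; apply: (face_weight_sub xs); rewrite lt0r r0 face_weight_ge0.
Qed.

End SubdivisionWeight.

Section OrderComplexContraction.
Local Open Scope fset_scope.
Local Open Scope ring_scope.
Variables (R : realType) (d : Order.disp_t) (T : porderType d) (P : set T).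
Variables (K : simplicial_complex T) (phi : {fset T} -> T).
Local Notation D := (order_complex P).

Hypothesis chainK : forall s, simplex D s -> simplex K s.
Hypothesis phiP : forall s, simplex K s -> P (phi s).
Hypothesis phi_anti : forall s t,
  simplex K t -> s != fset0 -> s `<=` t -> (phi t <= phi s)%O.
Hypothesis phi_chain : forall s, simplex D s -> phi s \in s.

Lemma inclusion_baryP (x : realization R D) :
  exists2 s, simplex K s & bary_in s x.
Proof. by have [s /chainK Ks xs] := carrier_ex x; exists s. Qed.

Definition inclusion x : realization R K := Realization (inclusion_baryP x).

Lemma continuous_inclusion : continuous inclusion.
Proof.
apply/continuousP => A oA.
suff : weak_open (inclusion @^-1` A)%classic by [].
move=> s Ds x Ax xs.
have [e e0 he] := oA s (chainK Ds) (inclusion x) Ax xs.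
by exists e => // y ys xy; exact: he.
Qed.

Lemma subdivision_simplex (z : realization R K * R) : exists2 s, simplex D s &
  forall rho, 0 < face_weight rho z.1 -> phi rho \in s.
Proof.
have [s Ks /bary_inE zs] := carrier_ex z.1.
pose Q := [fset rho in fpowerset s | 0 < face_weight rho z.1].
have QP rho : rho \in Q -> simplex K rho /\ 0 < face_weight rho z.1.
  rewrite !inE fpowersetE => /andP[rs rz]; split=> //.
  exact: simplex_sub Ks rs (face_weight_neq0 rz).
have inQ rho : 0 < face_weight rho z.1 -> rho \in Q.
  by move=> rz; rewrite !inE fpowersetE rz (face_weight_sub zs).
exists [fset phi rho | rho in Q]; last by move=> rho /inQ rQ; apply/imfsetP; exists rho.
split.
- have [rho /inQ rQ] := face_weight_ex z.1.
  by apply/fset0Pn; exists (phi rho); apply/imfsetP; exists rho.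
- by move=> _ /imfsetP[rho /= /QP[Kr _] ->]; exact: phiP.
- move=> _ _ /imfsetP[rho /= /QP[Kr rz] ->] /imfsetP[rho' /= /QP[Kr' rz'] ->].
  rewrite /Order.comparable.
  have [rr|rr] := orP (face_weight_chain rz rz').
    by apply/orP; right; apply: phi_anti => //; exact: face_weight_neq0 rz.
  by apply/orP; left; apply: phi_anti => //; exact: face_weight_neq0 rz'.
Qed.

Lemma face_weight_finite s : exists tau : {fset {fset T}},
  forall rho (z : realization R K * R), carried s z.1 -> rho \notin tau ->
    face_weight rho z.1 = 0.
Proof. by exists (fpowerset s) => rho z; exact: face_weight_eq0. Qed.

(** The faces of positive weight form a chain, which the order-reversing [phi]
sends to a chain of [P]. *)
Lemma subdivision_map : exists r : realization R K * R -> realization R D,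
  continuous r /\ forall (z : realization R K * R) tau,
    (forall rho, rho \notin tau -> face_weight rho z.1 = 0) ->
    forall v, r z v =
      weight_at phi (fun rho (z : realization R K * R) => face_weight rho z.1) tau z v.
Proof.
apply: weighted_map.
- exact: continuous_face_weight.
- by move=> rho z; exact: face_weight_ge0.
- exact: face_weight_finite.
- by move=> z; exact: face_weight_ex.
- exact: subdivision_simplex.
Qed.

Definition track_vertex (i : T + {fset T}) : T :=
  match i with inl v => v | inr rho => phi rho end.

(** The straight homotopy from the identity to the subdivision map. It stays in the
carrier of each point because [phi] picks a member of every chain. *)
Definition track_weight (i : T + {fset T}) (z : realization R D * R) : R :=
  match i with
  | inl v => (1 - clamp z.2) * z.1 v
  | inr rho => clamp z.2 * face_weight rho z.1
  end.

Definition track_indices s : {fset T + {fset T}} :=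
  [fset inl v | v in s] `|` [fset inr rho | rho in fpowerset s].

Lemma track_weight_eq0 s i z : carried s z.1 ->
  i \notin track_indices s ->
  track_weight i z = 0.
Proof.
move=> zs; rewrite !inE negb_or; case: i => [v|rho] /andP[h1 h2] /=.
  have vs : v \notin s by apply: contra h1 => vs; apply/imfsetP; exists v.
  by rewrite zs // mulr0.
rewrite (face_weight_eq0 zs) ?mulr0 //.
by apply: contra h2 => rs; apply/imfsetP; exists rho.
Qed.

Lemma track_map : exists l : realization R D * R -> realization R D,
  continuous l /\ forall z tau, (forall i, i \notin tau -> track_weight i z = 0) ->
    forall v, l z v = weight_at track_vertex track_weight tau z v.
Proof.
apply: weighted_map.
- move=> [v|rho] /=; apply: continuous_mulr.
  + by apply: continuous_subr; [exact: cst_continuous|exact: continuous_clamp].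
  + exact: continuous_coord.
  + exact: continuous_clamp.
  + exact: continuous_face_weight.
- move=> [v|rho] z /=; apply: mulr_ge0; rewrite ?subr_ge0 ?clamp_le1 ?clamp_ge0 //.
    exact: bary_ge0.
  exact: face_weight_ge0.
- move=> s; eexists => i z; exact: track_weight_eq0.
- move=> z; have [t1|t1] := ltP (clamp z.2) 1.
    have [v zv] := bary_ex_gt0 z.1; exists (inl v) => /=.
    by rewrite mulr_gt0 // subr_gt0.
  have [rho rz] := face_weight_ex z.1; exists (inr rho) => /=.
  by rewrite mulr_gt0 // (lt_le_trans _ t1).
- move=> z; have [s Ds /bary_inE zs] := carrier_ex z.1; exists s => //.
  move=> [v|rho] /= iz.
    apply: (bary_gt0 zs); rewrite lt0r bary_ge0 andbT.
    by apply: contraTneq iz => ->; rewrite mulr0 ltxx.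
  have rz : 0 < face_weight rho z.1.
    rewrite lt0r face_weight_ge0 andbT.
    by apply: contraTneq iz => ->; rewrite mulr0 ltxx.
  have rs := face_weight_sub zs rz.
  by apply: (fsubsetP rs); apply: phi_chain; exact: simplex_sub Ds rs (face_weight_neq0 rz).
Qed.

(** First the identity is deformed into inclusion followed by subdivision, then
the contraction [h] runs between these two maps. *)
Lemma order_complex_contraction (x0 : realization R K)
    (h : realization R K * R -> realization R K) :
  continuous h -> (forall x, h (x, 0) = x) -> (forall x, h (x, 1) = x0) ->
  exists (y0 : realization R D) (k : realization R D * R -> realization R D),
    [/\ continuous k, forall y, k (y, 0) = y & forall y, k (y, 1) = y0].
Proof.
move=> hc h0 h1.
have [r [rc rE]] := subdivision_map; have [l [lc lE]] := track_map.
pose f (z : realization R D * R) := r (h (inclusion z.1, z.2), 0).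
have ic : continuous (fun z : realization R D * R =>
    (inclusion z.1, z.2) : realization R K * R).
  move=> z; apply: (@cvg_pair _ _ _ _ (nbhs (inclusion z.1)) (nbhs z.2)).
    apply: (@continuous_comp _ _ _ fst inclusion); first exact: cvg_fst.
    exact: continuous_inclusion.
  exact: cvg_snd.
have jc : continuous (fun x : realization R K => (x, 0) : realization R K * R).
  move=> x.
  have idx : ((fun y : realization R K => y) @ nbhs x --> nbhs x)%classic by exact: cvg_id.
  exact: (@cvg_pair _ _ _ _ (nbhs x) (nbhs (0 : R)) _ _ _ _ _ idx (cvg_cst _)).
have hic : continuous (fun z : realization R D * R => h (inclusion z.1, z.2)).
  by move=> z; exact: (@continuous_comp _ _ _ _ h z (ic z) (hc _)).
have rjc : continuous (fun x : realization R K => r (x, 0)).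
  by move=> x; exact: (@continuous_comp _ _ _ _ r x (jc x) (rc _)).
have fc : continuous f.
  by move=> z; exact: (@continuous_comp _ _ _ _ _ z (hic z) (rjc _)).
have lf y : l (y, 1) = f (y, 0).
  apply: realization_ext => v; rewrite /f h0.
  have [s Ds /bary_inE ys] := carrier_ex y.
  rewrite (rE _ (fpowerset s)); last first.
    by move=> rho rs; exact: (@face_weight_eq0 _ _ _ s _ (inclusion y)).
  rewrite (lE _ [fset inr rho | rho in fpowerset s]).
    rewrite /weight_at; move: (fpowerset s) => F.
    rewrite !big_imfset /=; try by move=> ? ? _ _ [].
    rewrite clamp1; under eq_bigr do rewrite mul1r.
    by under [X in _ / X]eq_bigr do rewrite mul1r.
  move=> i; case: (boolP (i \in track_indices s)).
    rewrite !inE => /orP[/imfsetP[u _ ->] _|-> //] /=.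
    by rewrite clamp1 subrr mul0r.
  by move=> + _; exact: (@track_weight_eq0 s _ (y, 1)).
have l0 y : l (y, 0) = y.
  apply: realization_ext => v.
  have [s Ds /bary_inE ys] := carrier_ex y.
  rewrite (lE _ [fset inl v | v in s]).
    rewrite /weight_at !big_imfset /=; try by move=> ? ? _ _ [].
    rewrite clamp0; under eq_bigr do rewrite subr0 mul1r.
    under [X in _ / X]eq_bigr do rewrite subr0 mul1r.
    by rewrite (bary_sum ys) divr1 bary_indicator.
  move=> i; case: (boolP (i \in track_indices s)).
    by rewrite !inE => /orP[-> //|/imfsetP[rho _ ->] _] /=; rewrite clamp0 mul0r.
  by move=> + _; exact: (@track_weight_eq0 s _ (y, 0)).
have [k [kc k0 k1]] := glue_homotopies lc fc lf.
by exists (r (x0, 0)), k; split=> // y; rewrite ?k0 // k1 /f h1.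
Qed.

End OrderComplexContraction.

(** * Arithmetic and cosets *)

Section Arithmetic.

Lemma infinite_set_gt (P : set nat) (n : nat) :
  infinite_set P -> exists2 p, P p & n < p.
Proof.
move=> Pinf; apply: contrapT => Hn; apply: Pinf.
apply: (@sub_finite_set _ _ `I_n.+1); last exact: finite_II.
by move=> p Pp /=; rewrite ltnS leqNgt; apply/negP => np; apply: Hn; exists p.
Qed.

(** Requiring [n] to be a multiple of [m] is one more congruence, so the modulus
starts at [m]; repeated primes are harmless as the residue depends only on the
prime. *)
Lemma chinese_primes (m : nat) (s : seq nat) (r : nat -> nat) :
  (forall q, q \in s -> prime q /\ coprime m q) ->
  exists2 n, m %| n & forall q, q \in s -> n = r q %[mod q].
Proof.
elim: s => [|q s IHs] sP; first by exists 0; rewrite // dvdn0.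
have [n mn nr] : exists2 n, m %| n & forall q, q \in s -> n = r q %[mod q].
  by apply: IHs => q' q's; apply: sP; rewrite inE q's orbT.
have [qs|qs] := boolP (q \in s).
  by exists n => // q'; rewrite inE => /orP[/eqP->|]; exact: nr.
pose N := m * \prod_(q' <- undup s) q'.
have dvdN q' : q' \in s -> q' %| N.
  move=> q's; rewrite /N (big_rem q') ?mem_undup //=.
  by apply: dvdn_mull; exact: dvdn_mulr.
have cop : coprime N q.
  have [pq cq] := sP q (mem_head _ _).
  rewrite coprimeMl cq /= big_seq; elim/big_ind : _ => [|x y ? ?|q' q's].
  - exact: coprime1n.
  - by rewrite coprimeMl; apply/andP.
  - move: q's; rewrite mem_undup => q's.
    have [pq' _] : prime q' /\ coprime m q' by apply: sP; rewrite inE q's orbT.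
    rewrite prime_coprime // dvdn_prime2 //.
    by apply: contra qs => /eqP <-.
have nN := chinese_modl cop n (r q).
exists (chinese N q n (r q)).
  have mN : m %| N by exact: dvdn_mulr.
  by rewrite /dvdn -(modn_dvdm _ mN) nN (modn_dvdm _ mN).
move=> q'; rewrite inE => /orP[/eqP->|q's]; first exact: chinese_modr.
by rewrite -(modn_dvdm _ (dvdN _ q's)) nN (modn_dvdm _ (dvdN _ q's)) nr.
Qed.

Lemma finite_range_collision (T : choiceType) (A : set T) (f : nat -> T) :
  finite_set A -> (forall i, A (f i)) -> exists i j, i < j /\ f i = f j.
Proof.
move=> /finite_seqP[s ->] fs; pose l := [seq f i | i <- iota 0 (size s).+1].
have /(uniqPn (f 0))[i [j [ij jl fij]]] : ~~ uniq l.
  apply/negP => ul; have := uniq_leq_size ul (s2 := s).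
  rewrite size_map size_iota ltnn => H; suff : false by [].
  by apply: H => x /mapP[i _ ->]; exact: fs.
move: jl; rewrite size_map size_iota => jl.
exists i, j; split=> //; have il := ltn_trans ij jl.
by move: fij; rewrite !(nth_map 0) ?size_iota // !nth_iota.
Qed.

End Arithmetic.

Section Cosets.
Local Open Scope classical_set_scope.
Local Open Scope group_scope.
Variable G : groupType.
Implicit Types (H K C : set G) (g x y : G).

Lemma subgroupP H : subgroup H <->
  [/\ H 1, forall x y, H x -> H y -> H (x * y) & forall x, H x -> H x^-1].
Proof.
split=> [Hs|[H1 HM HV]]; last first.
  split; first exact/mem_set.
  by move=> x y /set_mem Hx /set_mem Hy; apply/mem_set/HM => //; exact: HV.
have HM := group_closedM Hs; have HV := group_closedV Hs; have [/set_mem H1 _] := Hs.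
split=> // [x y Hx Hy|x Hx]; apply: set_mem.
  by apply: HM; exact: mem_set.
by apply: HV; exact: mem_set.
Qed.

Lemma right_cosetE H g x : right_coset H g x <-> H (x * g^-1).
Proof.
split=> [[h Hh <-]|Hx]; first by rewrite mulgK.
by exists (x * g^-1) => //; rewrite mulgVK.
Qed.

Lemma right_coset_id H g : subgroup H -> right_coset H g g.
Proof. by move=> /subgroupP[H1 _ _]; apply/right_cosetE; rewrite mulgV. Qed.

Lemma right_coset_eq H x g :
  subgroup H -> right_coset H g x -> right_coset H g = right_coset H x.
Proof.
move=> /subgroupP[H1 HM HV] /right_cosetE Hxg; apply/seteqP; split=> y /right_cosetE Hy;
  apply/right_cosetE.
  have -> : y * x^-1 = (y * g^-1) * (x * g^-1)^-1 by rewrite invgM invgK mulgA mulgVK.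
  by apply: HM => //; exact: HV.
have -> : y * g^-1 = (y * x^-1) * (x * g^-1) by rewrite mulgA mulgVK.
exact: HM.
Qed.

Lemma right_coset1 H : right_coset H 1 = H.
Proof.
by apply/seteqP; split=> x; rewrite right_cosetE invg1 mulg1.
Qed.

Lemma right_cosets_at HH C x :
  (forall H, HH H -> subgroup H) -> right_cosets HH C -> C x ->
  exists2 H, HH H & C = right_coset H x.
Proof.
move=> HHs [H HHH [g ->]] Hx; exists H => //; apply: right_coset_eq Hx; exact: HHs.
Qed.

Lemma Hfi_subgroup H : Hfi G H -> subgroup H. Proof. by case. Qed.

Lemma HfiI H K : Hfi G H -> Hfi G K -> Hfi G (H `&` K).
Proof.
move=> [Hs HT Hf] [Ks KT Kf]; split.
- have [H1 HM HV] := proj1 (subgroupP H) Hs; have [K1 KM KV] := proj1 (subgroupP K) Ks.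
  apply/subgroupP; split=> // [x y [? ?] [? ?]|x [? ?]]; split; auto.
- apply: contra_neq HT => HK; apply/seteqP; split=> // x _.
  by have : [set: G] x by []; rewrite -HK => -[].
- apply: (@sub_finite_set _ _ ((fun A : set G * set G => A.1 `&` A.2) @`
    (range (right_coset H) `*` range (right_coset K)))).
    move=> _ [g _ <-]; exists (right_coset H g, right_coset K g).
      by split=> /=; exists g.
    apply/seteqP; split=> x /=.
      by move=> [/right_cosetE ? /right_cosetE ?]; apply/right_cosetE.
    by move=> /right_cosetE[? ?]; split; apply/right_cosetE.
  by apply: finite_image; exact: finite_setX.
Qed.

Lemma right_cosetI H K g :
  right_coset H g `&` right_coset K g = right_coset (H `&` K) g.
Proof.
apply/seteqP; split=> x /=.
  by move=> [/right_cosetE ? /right_cosetE ?]; apply/right_cosetE.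
by move=> /right_cosetE[? ?]; split; apply/right_cosetE.
Qed.

Lemma bigcap_right_cosets (s : seq (set G)) g : s != [::] ->
  (forall C, C \in s -> Pfi G C) -> (forall C, C \in s -> C g) ->
  exists2 H, Hfi G H & \bigcap_(C in [set` s]) C = right_coset H g.
Proof.
elim: s => // C s IHs _ sP sg.
have [H HH CE] := right_cosets_at Hfi_subgroup (sP C (mem_head _ _)) (sg C (mem_head _ _)).
have [s0|s0] := eqVneq s [::].
  exists H => //; rewrite s0 -CE; apply/seteqP; split=> x.
    by apply; rewrite /= inE.
  by move=> Cx D /=; rewrite inE => /eqP ->.
have [D Ds|D Ds|K HK sE] := IHs s0.
- by apply: sP; rewrite inE Ds orbT.
- by apply: sg; rewrite inE Ds orbT.
exists (H `&` K); first exact: HfiI.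
rewrite -right_cosetI -CE -sE; apply/seteqP; split=> x.
  move=> Hx; split; first by apply: Hx; rewrite /= mem_head.
  by move=> D Ds; apply: Hx; rewrite /= inE Ds orbT.
by move=> [Cx sx] D /=; rewrite inE => /orP[/eqP ->|/sx].
Qed.

Lemma chain_min (s : seq (set G)) : s != [::] ->
  {in s &, forall C D : set G, (C >=< D)%O} ->
  exists2 C, C \in s & forall D, D \in s -> C `<=` D.
Proof.
elim: s => // C s IHs _ sc.
have [s0|s0] := eqVneq s [::].
  by exists C; rewrite ?mem_head // s0 => D; rewrite inE => /eqP ->.
have [D E Ds Es|M Ms Mmin] := IHs s0.
  by apply: sc; rewrite inE ?Ds ?Es orbT.
have := sc C M (mem_head _ _); rewrite inE Ms orbT => /(_ isT).
move=> /orP[]; rewrite subsetEset => CM.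
  exists C; rewrite ?mem_head // => D; rewrite inE => /orP[/eqP ->//|/Mmin].
  exact: subset_trans.
exists M; rewrite ?inE ?Ms ?orbT // => D; rewrite inE => /orP[/eqP -> //|].
exact: Mmin.
Qed.

End Cosets.

(** * Coset complexes with large prime cycles *)

Section CosetComplexes.
Local Open Scope group_scope.
Variables (G : groupType) (w : G) (P : set nat) (H : nat -> set G).
Hypothesis Pinf : infinite_set P.
Hypothesis Pprime : forall p, P p -> prime p.
Hypothesis Hfin : forall p, P p -> Hfi G (H p).
Hypothesis Hw : forall p, P p -> H p (w ^+ p).
Hypothesis Hcycle : forall p g, P p -> exists i, right_coset (H p) (w ^+ i) g.

Lemma expg_subgroup (K : set G) x n : subgroup K -> K x -> K (x ^+ n).
Proof.
move=> /subgroupP[K1 KM KV] Kx; elim: n => [|n IHn]; first by rewrite expg0.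
by rewrite expgS; exact: KM.
Qed.

(** [w ^+ p] lies in [H p], and so do its powers. *)
Lemma mem_cycle_mod p m n g : P p -> m = n %[mod p] ->
  H p (w ^+ m * g) -> H p (w ^+ n * g).
Proof.
move=> Pp mn; have Hs := Hfi_subgroup (Hfin Pp); have [H1 HM HV] := proj1 (subgroupP _) Hs.
have Hk k : H p (w ^+ (k * p)) by rewrite mulnC expgnA; apply: expg_subgroup; [|exact: Hw].
rewrite (divn_eq m p) (divn_eq n p) mn !expgnDr -!mulgA => Hm.
apply: (HM) => //.
rewrite -[_ * g](mulKg (w ^+ (m %/ p * p))); apply: (HM) => //; exact: HV.
Qed.

(** Two powers of [w] lie in the same coset of the underlying subgroup; their
quotient is a power of [w] in that subgroup, hence preserves each of its right
cosets under left multiplication. *)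
Lemma coset_period (C : set G) : Pfi G C ->
  exists m, 0 < m /\ forall n y, m %| n -> C y -> C (w ^+ n * y).
Proof.
move=> [K KH [g ->]]; have [Ks _ Kf] := KH.
have [i [j [ij Kij]]] := finite_range_collision (f := fun i => right_coset K (w ^+ i))
  Kf (fun i => ex_intro2 _ _ (w ^+ i) I erefl).
exists (j - i)%N; split; first by rewrite subn_gt0.
have [K1 KM KV] := proj1 (subgroupP _) Ks.
have Kw : K (w ^+ (j - i)).
  have : right_coset K (w ^+ i) (w ^+ j) by rewrite Kij; exact: right_coset_id.
  by move=> /right_cosetE; rewrite -{1}(subnK (ltnW ij)) expgnDr mulgK.
move=> _ y /dvdnP[k ->] /right_cosetE Ky; apply/right_cosetE.
rewrite -mulgA; apply: KM => //.
by rewrite mulnC expgnA; exact: expg_subgroup.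
Qed.

Lemma period_ex (C : set G) : exists m, 0 < m /\
  (Pfi G C -> forall n y, m %| n -> C y -> C (w ^+ n * y)).
Proof.
have [/coset_period[m [m0 mP]]|nC] := pselect (Pfi G C); first by exists m.
by exists 1%N.
Qed.

Definition period C : nat := sval (cid (period_ex C)).

Lemma period_gt0 C : 0 < period C.
Proof. by rewrite /period; case: cid => m []. Qed.

Lemma periodP C n y : Pfi G C -> period C %| n -> C y -> C (w ^+ n * y).
Proof. by rewrite /period; case: cid => m /= [_ mP] /mP; exact. Qed.

Definition total_period (s : {fset set G}) : nat := (\prod_(C <- s) period C)%N.

Lemma total_period_gt0 s : 0 < total_period s.
Proof. by rewrite /total_period; apply: prodn_gt0 => C; exact: period_gt0. Qed.

Lemma dvdn_total_period s C : C \in s -> period C %| total_period s.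
Proof.
by move=> Cs; rewrite /total_period (big_fsetD1 C) //= dvdn_mulr.
Qed.

Lemma total_period_sub s t : (s `<=` t)%fset -> total_period s %| total_period t.
Proof.
move=> /fsetIidPr st; rewrite /total_period [X in _ %| X](big_fsetID _ (mem s)) /=.
rewrite (_ : [fset x in t | x \in s]%fset = s) ?dvdn_mulr //.
by rewrite -[RHS]st; apply/fsetP => C; rewrite !inE.
Qed.

Lemma apex_prime_ex (s : {fset set G}) : exists p, P p /\ total_period s < p.
Proof. by have [p Pp sp] := infinite_set_gt (total_period s) Pinf; exists p. Qed.

(** A prime above the total period of [s] is coprime to it, and then also to the
total period of every subset of [s]. *)
Definition apex_prime s : nat := sval (cid (apex_prime_ex s)).

Lemma apex_primeP s : P (apex_prime s).
Proof. by rewrite /apex_prime; case: cid => p []. Qed.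

Lemma coprime_apex_prime s t : (s `<=` t)%fset ->
  coprime (total_period s) (apex_prime t).
Proof.
move=> st; rewrite coprime_sym prime_coprime; last exact/Pprime/apex_primeP.
apply/negP => /dvdn_trans /(_ (total_period_sub st)) /dvdn_leq.
move=> /(_ (total_period_gt0 _)); rewrite leqNgt => /negP; apply.
by rewrite /apex_prime; case: cid => p [].
Qed.

Definition apex s : set G := H (apex_prime s).

Lemma apex_coset s : Pfi G (apex s).
Proof.
exists (apex s); first exact/Hfin/apex_primeP.
by exists 1; rewrite right_coset1.
Qed.

(** The common point of the cosets in [S] is translated by a power of [w] whose
exponent is a multiple of their periods and has the residue that each apex
[H p] prescribes modulo [p]. *)
Lemma apex_cone : cone_apex (nerve_complex (Hfi G)) apex.
Proof.
move=> S Q SP SQ ne; split=> // [C|].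
  rewrite inE => /orP[CS|/imfsetP[rho _ ->]]; last exact: apex_coset.
  by case: SP => [S0|[_ Sc _]]; [move: CS; rewrite S0 inE|exact: Sc].
have [g Sg] : exists g, forall C, C \in S -> C g.
  by case: SP => [->|[_ _ [g gS]]]; [exists 1|exists g].
have SPfi C : C \in S -> Pfi G C.
  by case: SP => [->|[_ Sc _]] // CS; exact: Sc.
have resP p : exists i, P p -> H p (w ^+ i * g).
  have [Pp|] := pselect (P p); last by exists 0%N.
  have [i /right_cosetE Hi] := Hcycle g^-1 Pp; exists i => _.
  have [_ _ HV] := proj1 (subgroupP _) (Hfi_subgroup (Hfin Pp)).
  by have := HV _ Hi; rewrite invgM !invgK.
have [res resE] := choice resP.
have [q|n Sn nres] := @chinese_primes (total_period S)
  [seq apex_prime rho | rho <- Q] res.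
  move=> /mapP[rho rQ ->]; split; first exact/Pprime/apex_primeP.
  by apply: coprime_apex_prime; exact: SQ.
exists (w ^+ n * g) => C /=; rewrite inE => /orP[CS|/imfsetP[rho /= rQ ->]].
  apply: periodP; [exact: SPfi| |exact: Sg].
  by apply: dvdn_trans Sn; exact: dvdn_total_period.
apply: (@mem_cycle_mod _ (res (apex_prime rho))); first exact: apex_primeP.
  by rewrite nres // map_f.
exact/resE/apex_primeP.
Qed.

Variable R : realType.

Lemma coset_complexes_contractible :
  contractible R (realization R (nerve_complex (Hfi G))) /\
  contractible R (realization R (order_complex (Pfi G))).
Proof.
have [x0 [h [hc h0 h1]]] := cone_contraction R apex_cone.
split; first by exists x0, h; split=> //; exact: continuous_subspaceT.
have enum0 (s : {fset set G}) : s != fset0 -> enum_fset s != [::].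
  by apply: contra => /eqP se; apply/eqP/fsetP => C; rewrite in_fset0 -[LHS]/(C \in enum_fset s) se.
(* The simplices of the two complexes are sets of the same cosets; [meet] is the
   order-reversing map from the nerve complex to the poset. *)
pose meet (s : {fset set G}) : set G := (\bigcap_(C in [set` s]) C)%classic.
have meet_min (s : {fset set G}) : simplex (order_complex (Pfi G)) s ->
    exists2 C, C \in s & meet s = C.
  move=> [s0 sP sc].
  have [C Cs Cmin] := chain_min (enum0 _ s0) sc.
  exists C => //; apply/seteqP; split=> x; first exact.
  by move=> Cx D /Cmin; exact.
have [y0 [k [kc k0 k1]]] : exists (y0 : realization R (order_complex (Pfi G)))
    (k : realization R (order_complex (Pfi G)) * R ->
      realization R (order_complex (Pfi G))),
    [/\ continuous k, forall y, k (y, 0%R) = y & forall y, k (y, 1%R) = y0].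
  apply: (@order_complex_contraction R _ (set G) (Pfi G)
    (nerve_complex (Hfi G)) meet _ _ _ _ x0 h hc h0 h1).
  - move=> s Ds; have [s0 sP sc] := Ds; split=> //.
    have [C Cs CE] := meet_min s Ds; have [K KH [g Cg]] := sP C Cs.
    exists g; rewrite -[X in X g]/(meet s) CE Cg.
    exact/right_coset_id/Hfi_subgroup.
  - move=> s [s0 sP [g sg]].
    have [K KH KE] := bigcap_right_cosets (enum0 _ s0) sP sg.
    by exists K => //; exists g.
  - move=> s t _ _ /fsubsetP st; rewrite subsetEset => x tx C /= /st; exact: tx.
  - by move=> s /meet_min[C Cs ->].
by exists y0, k; split=> //; exact: continuous_subspaceT.
Qed.

End CosetComplexes.

(** * Actions given by labelled graphs *)

Section Walks.
Local Open Scope group_scope.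
Variables (X : choiceType) (Gamma : xgraph X).
Hypothesis reg : xregular Gamma.
Implicit Types (u v : vertex Gamma) (a : X * bool) (s t : seq (X * bool)).

Lemma edge_at_ex v a : exists e : hedge Gamma,
  [/\ horigin e = v, hlabel e = a &
    forall e' : hedge Gamma, horigin e' = v -> hlabel e' = a -> e' = e].
Proof.
have [e [[ev ea] eu]] := reg v a; exists e; split=> // e' e'v e'a.
by apply/esym/eu.
Qed.

Definition edge_at v a : hedge Gamma := sval (cid (edge_at_ex v a)).

Lemma edge_at_unique v a (e : hedge Gamma) :
  horigin e = v -> hlabel e = a -> edge_at v a = e.
Proof.
by move=> ev ea; rewrite /edge_at; case: cid => e' /= [_ _ eu]; rewrite (eu e).
Qed.

Lemma edge_at_origin v a : horigin (edge_at v a) = v.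
Proof. by rewrite /edge_at; case: cid => e' /= []. Qed.

Lemma edge_at_label v a : hlabel (edge_at v a) = a.
Proof. by rewrite /edge_at; case: cid => e' /= []. Qed.

Definition step v a : vertex Gamma := hterminus (edge_at v a).

Definition walk v s : vertex Gamma := foldl step v s.

Lemma stepK v a : step (step v a) (linv a) = v.
Proof.
rewrite {1}/step (@edge_at_unique _ _ (hinv (edge_at v a))).
- by rewrite -[RHS](edge_at_origin v a) /hterminus /horigin /=; case: (edge_at v a).2.
- by rewrite /step /hterminus /horigin /=; case: (edge_at v a).2.
- by rewrite -[in RHS](edge_at_label v a).
Qed.

Lemma walk_push v a s : walk v (push a s) = walk (step v a) s.
Proof. by case: s => //= b s; case: eqP => [->|//] /=; rewrite stepK. Qed.

Lemma walkM v (r s : free_group X) : walk v (r * s) = walk (walk v r) s.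
Proof.
rewrite -[LHS]/(walk v (redcat r s)).
by elim: (fgword r) v => //= a t IHt v; rewrite walk_push IHt.
Qed.

Lemma walkVK v (r : free_group X) : walk (walk v r) r^-1 = v.
Proof. by rewrite -walkM mulgV. Qed.

Lemma walk_inj (r : free_group X) u v : walk u r = walk v r -> u = v.
Proof. by move=> uv; rewrite -(walkVK u r) uv walkVK. Qed.

(** The walk along a freely reduced word is automatically a reduced path: a
backtracking would show as two adjacent inverse letters. *)
Lemma readsE v (r : free_group X) u : reads v r u <-> walk v r = u.
Proof.
split=> [[p [vpu _ <-]]|<-].
  elim: p v vpu => [|e p IHp] v //= [ev epu].
  by rewrite /step (edge_at_unique ev erefl) IHp.
have [p [vp pr]] : exists p : seq (hedge Gamma),
    is_path v p (walk v r) /\ path_label p = r.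
  elim: (fgword r) v => [|a s IHs] v; first by exists [::].
  have [p [sp ps]] := IHs (step v a); exists (edge_at v a :: p); split=> /=.
    by split=> //; exact: edge_at_origin.
  by rewrite edge_at_label ps.
exists p; split=> // p1 e p2 pE.
have := fgword_reduced r; rewrite -pr pE /path_label map_cat /freely_reduced /=.
by move=> /cat_sorted2[_] /=; rewrite eqxx.
Qed.

(** The words that fix every vertex form a normal subgroup. *)
Lemma walk_normal_closure (R1 : set (free_group X)) v (r : free_group X) :
  fulfills Gamma R1 -> normal_closure R1 r -> walk v r = v.
Proof.
move=> fR /(_ [set s : free_group X | forall u, walk u s = u]%classic); apply.
split; last first.
  move=> s R1s u; exact: (fR _ _ _ R1s (Logic.proj2 (readsE _ _ _) erefl)).
split.
  apply/subgroupP; split=> //.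
    by move=> x y hx hy u; rewrite walkM hx hy.
  by move=> x hx u; rewrite -{1}(hx u) walkVK.
move=> s g hs u; rewrite /conjg !walkM hs.
by rewrite -walkM mulVg.
Qed.

End Walks.

Section MultiplicativeMaps.
Local Open Scope group_scope.
Variables (G H : groupType) (h : G -> H).
Hypothesis hM : {morph h : x y / x * y}.

Lemma morph_one : h 1 = 1.
Proof. by apply: (@mulgI _ (h 1)); rewrite -hM !mulg1. Qed.

Lemma morph_inv x : h x^-1 = (h x)^-1.
Proof. by apply: (@mulgI _ (h x)); rewrite -hM !mulgV morph_one. Qed.

End MultiplicativeMaps.

Section PrimeIndexSubgroup.
Local Open Scope group_scope.
Variables (X : choiceType) (Gamma : xgraph X) (R1 : set (free_group X)).
Variables (G1 G : groupType) (f : {multiplicative free_group X -> G1}).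
Variables (proj : G -> G1) (w : free_group X) (w' : G) (p : nat).
Hypothesis f_surj : range f = setT.
Hypothesis f_ker : (f @^-1` [set 1] = normal_closure R1)%classic.
Hypothesis projM : {morph proj : x y / x * y}.
Hypothesis proj_w : proj w' = f w.
Hypothesis reg : xregular Gamma.
Hypothesis ful : fulfills Gamma R1.
Hypothesis p_prime : prime p.
Hypothesis card_vertex : ([set: vertex Gamma] #= `I_p)%card.
Variable v : vertex Gamma.
Hypothesis vP : [set u | exists2 i, (i < p)%N & reads v (w ^+ i) u]%classic
  = [set: vertex Gamma]%classic.

Let fM : {morph f : x y / x * y}. Proof. exact: gmulfM. Qed.

(** The action of the free group on the vertices factors through [G1], since the
kernel of [f] is the normal closure of the relators. *)
Lemma walk_f (r s : free_group X) u : f r = f s -> walk reg u r = walk reg u s.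
Proof.
move=> rs; apply: (@walk_inj _ _ reg s^-1); rewrite walkVK -walkM.
apply: (walk_normal_closure reg u ful); rewrite -f_ker /=.
by rewrite gmulfM rs (morph_inv fM) mulgV.
Qed.

Let c i := walk reg v (w ^+ i).

Let cD i j : c (i + j) = walk reg (c i) (w ^+ j).
Proof. by rewrite /c expgnDr walkM. Qed.

Lemma cycle_vertex u : exists2 i, i < p & c i = u.
Proof.
have : [set: vertex Gamma]%classic u by [].
by rewrite -vP => -[i ip /(readsE reg) <-]; exists i.
Qed.

(** If the orbit of [v] under [w] closed up after [d] steps, it would have at most
[d] points, but it exhausts the [p] vertices. *)
Lemma period_le d : 0 < d -> c d = v -> p <= d.
Proof.
move=> d0 cd; have cE i : c i = c (i %% d).
  rewrite {1}(divn_eq i d); elim: (i %/ d) => [|k IHk]; first by rewrite mul0n.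
  by rewrite mulSn -addnA cD cd.
have : (`I_p #<= `I_d)%card.
  rewrite -(card_le_eql card_vertex).
  apply: card_le_trans (card_image_le c `I_d); apply: subset_card_le => u _.
  by have [i _ <-] := cycle_vertex u; exists (i %% d); rewrite //= ltn_pmod.
by rewrite card_le_II.
Qed.

(** [c p] repeats an earlier [c i], so the orbit closes up after [p - i] steps;
minimality forces [i = 0]. *)
Lemma cycle_closed : c p = v.
Proof.
have [i ip ci] := cycle_vertex (c p).
have cpi : c (p - i) = v.
  have ci' : walk reg (c (p - i)) (w ^+ i) = walk reg v (w ^+ i).
    by rewrite -cD subnK ?(ltnW ip).
  exact: walk_inj ci'.
have : p <= p - i by apply: period_le; rewrite ?subn_gt0.
have [i0|i0] := posnP i; first by rewrite -ci i0 /c expg0.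
by rewrite leqNgt ltn_subrL i0 prime_gt0.
Qed.

(** The stabilizer of [v] under the action of [G] through [G1]; by [walk_f] the
choice of the word [r] does not matter. *)
Definition vertex_stabilizer : set G :=
  [set g | exists2 r, f r = proj g & walk reg v r = v]%classic.

Lemma proj_wX i : proj (w' ^+ i) = f (w ^+ i).
Proof.
elim: i => [|i IHi]; first by rewrite !expg0 (morph_one projM) (morph_one fM).
by rewrite !expgS projM gmulfM IHi proj_w.
Qed.

Lemma stabilizer_subgroup : subgroup vertex_stabilizer.
Proof.
apply/subgroupP; split.
- by exists 1; rewrite ?(morph_one fM) ?(morph_one projM).
- move=> x y [r rx rv] [s sy sv]; exists (r * s); first by rewrite gmulfM rx sy projM.
  by rewrite walkM rv sv.
- move=> x [r rx rv]; exists r^-1; first by rewrite (morph_inv fM) rx (morph_inv projM).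
  by rewrite -{1}rv walkVK.
Qed.

Lemma stabilizer_power i : vertex_stabilizer (w' ^+ i) <-> c i = v.
Proof.
split=> [[r]|ci]; last by exists (w ^+ i); rewrite ?proj_wX.
by rewrite proj_wX => /walk_f rw rv; rewrite /c -rw.
Qed.

Lemma stabilizer_transversal g :
  exists2 i, i < p & right_coset vertex_stabilizer (w' ^+ i) g.
Proof.
have [r _ rg] : range f (proj g) by rewrite f_surj.
have [i ip ci] := cycle_vertex (walk reg v r); exists i => //.
apply/right_cosetE; exists (r * (w ^+ i)^-1).
  by rewrite gmulfM (morph_inv fM) rg -proj_wX projM (morph_inv projM).
by rewrite walkM -ci /c walkVK.
Qed.

(** Had the stabilizer been all of [G], the vertex [v] would be fixed by [w], and
the cycle would have length 1. *)
Lemma prime_index_subgroup : exists H : set G,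
  [/\ Hfi G H, H (w' ^+ p) & forall g, exists i, right_coset H (w' ^+ i) g].
Proof.
exists vertex_stabilizer; split.
- split; first exact: stabilizer_subgroup.
    apply/negP => /eqP HT; have : p <= 1.
      by apply: period_le => //; apply/stabilizer_power; rewrite HT.
    by rewrite leqNgt prime_gt1.
  apply: (@sub_finite_set _ _ [set right_coset vertex_stabilizer (w' ^+ i) | i in `I_p]%classic).
    move=> _ [g _ <-]; have [i ip gi] := stabilizer_transversal g.
    exists i => //; exact: right_coset_eq stabilizer_subgroup gi.
  by apply: finite_image; exact: finite_II.
- exact/stabilizer_power/cycle_closed.
- by move=> g; have [i _ gi] := stabilizer_transversal g; exists i.
Qed.

End PrimeIndexSubgroup.

Section FreeProductProjection.
Local Open Scope group_scope.
Variables G1 G2 : groupType.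

Definition fp_word_proj1 (s : seq (G1 + G2)) : G1 :=
  \prod_(x <- s) (if x is inl a then a else 1).

Lemma fp_word_proj1_cat s t :
  fp_word_proj1 (s ++ t) = fp_word_proj1 s * fp_word_proj1 t.
Proof. exact: big_cat. Qed.

Lemma fp_word_proj1_eq s t : fp_eq s t -> fp_word_proj1 s = fp_word_proj1 t.
Proof.
elim=> {s t} // [s t u _ -> _ -> //|s t|s t|s a b t|s c d t];
by rewrite !fp_word_proj1_cat /fp_word_proj1 !big_cons ?mul1g ?mulgA.
Qed.

Definition fp_proj1 (x : free_product G1 G2) : G1 := fp_word_proj1 (repr x).

Lemma fp_proj1_pi s : fp_proj1 (\pi_(free_product G1 G2)%qT s) = fp_word_proj1 s.
Proof. exact/fp_word_proj1_eq/fp_reprP. Qed.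

Lemma fp_proj1M : {morph fp_proj1 : x y / x * y}.
Proof. by move=> x y; rewrite fp_proj1_pi fp_word_proj1_cat. Qed.

End FreeProductProjection.

Section Lift.
Local Open Scope group_scope.
Variables (R : realType) (X1 : finType) (R1 : set (free_group X1)).
Variables (G1 : groupType) (hG1 : presented_by R1 G1).
Variables (P : set nat) (Pinf : infinite_set P) (Pprime : forall p, P p -> prime p).
Variables (w : free_group X1) (Gamma : nat -> xgraph X1).
Hypothesis hGamma : forall p, P p ->
      [/\ xregular (Gamma p), xconnected (Gamma p), fulfills (Gamma p) R1,
          ([set: vertex (Gamma p)] #= `I_p)%card
        & exists v : vertex (Gamma p),
            [set u | exists2 i, (i < p)%N & reads v (w ^+ i)%g u]%classic
            = [set: vertex (Gamma p)]%classic].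

Lemma coset_complexes_contractible_over (G : groupType) (proj : G -> G1) :
  {morph proj : x y / x * y} -> (forall a, exists g, proj g = a) ->
  contractible R (realization R (nerve_complex (Hfi G))) /\
  contractible R (realization R (order_complex (Pfi G))).
Proof.
move=> projM proj_surj; have [f [f_surj f_ker]] := hG1.
have [w' w'w] := proj_surj (f w).
have HP p : exists H : set G, P p ->
    [/\ Hfi G H, H (w' ^+ p) & forall g, exists i, right_coset H (w' ^+ i) g].
  have [Pp|] := pselect (P p); last by exists setT.
  have [reg _ ful card_vertex [v vP]] := hGamma Pp.
  have [H HP] := prime_index_subgroup f_surj f_ker projM w'w reg ful
    (Pprime Pp) card_vertex vP.
  by exists H.
have [H HE] := choice HP.
apply: (@coset_complexes_contractible G w' P H) => // p.
- by move=> /HE[].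
- by move=> /HE[].
- by move=> g /HE[].
Qed.

End Lift.

Theorem theorem6p4 (R : realType) (X1 X2 : finType)
    (R1 : set (free_group X1)) (R2 : set (free_group X2))
    (G1 G2 : groupType)
    (hG1 : presented_by R1 G1) (hG2 : presented_by R2 G2)
    (P : set nat) (Pinf : infinite_set P) (Pprime : forall p, P p -> prime p)
    (w : free_group X1) (Gamma : nat -> xgraph X1)
    (hGamma : forall p, P p ->
      [/\ xregular (Gamma p), xconnected (Gamma p), fulfills (Gamma p) R1,
          ([set: vertex (Gamma p)] #= `I_p)%card
        & exists v : vertex (Gamma p),
            [set u | exists2 i, (i < p)%N & reads v (w ^+ i)%g u]%classic
            = [set: vertex (Gamma p)]%classic]) :
  [/\ contractible R (realization R (nerve_complex (Hfi (free_product G1 G2))))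
      /\ contractible R
           (realization R (order_complex (Pfi (free_product G1 G2)))),
      contractible R (realization R (nerve_complex (Hfi (G1 * G2)%type)))
      /\ contractible R (realization R (order_complex (Pfi (G1 * G2)%type)))
    & forall phi : {multiplicative G1 -> aut G2},
      contractible R (realization R (nerve_complex (Hfi (semidirect phi))))
      /\ contractible R (realization R (order_complex (Pfi (semidirect phi))))].
Proof.
have key := coset_complexes_contractible_over R hG1 Pinf Pprime hGamma.
split=> [||phi].
- apply: (key _ _ (@fp_proj1M G1 G2)) => a.
  exists (\pi_(free_product G1 G2)%qT [:: inl a]).
  by rewrite fp_proj1_pi /fp_word_proj1 big_seq1.
- by apply: (key _ (fun x : G1 * G2 => x.1)) => // a; exists (a, 1%g).
- apply: (key _ (fun x : semidirect phi => sd_top x)) => // a.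
  by exists (Semidirect phi 1%g a).
Qed.
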